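(* Let $\varphi$ be a random dynamical system with memoryless noise on the state space $X$ (setting described in the context), let $\rho$ be an ergodic probability measure of the Markov transition probabilities $(\varphi_x^t)$, and suppose that $\varphi$ is stable with respect to $\rho$. Then the following statements are equivalent: (i) there is a Borel set $R \subset X$ with $\rho(R)>0$ such that for each $p \in R$, the set $\mathfrak{C}_p$ contains a $\rho$-full-length rectangle; (ii) the set $\mathfrak{C}_{A_\rho}$ contains a $\rho$-full-length rectangle; (iii) $\varphi$ is $\rho$-almost everywhere stably synchronising; (iv) there is a $\rho$-full set $A \subset \mathrm{supp}\,\rho$ such that for any $x,y \in A$, $\mathbb{P}$-almost every $\omega \in \Omega$ has the property that for every open $U \subset X$ with $\rho(U)>0$ there exists $t \in \mathbb{T}^+$ such that $\varphi(t,\omega)x \in U$ and $\varphi(t,\omega)y \in U$.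
   Context: Setting. $\mathbb{T}$ is $\mathbb{Z}$ or $\mathbb{R}$, $\mathbb{T}^+ := \mathbb{T}\cap[0,\infty)$. $(\Omega,\mathcal{F})$ is a measurable space with sub-$\sigma$-algebras $(\mathcal{F}_s^{s+t})_{s\in\mathbb{T},t\in\mathbb{T}^+}$ such that $\mathcal{F}_{t_1}^{t_2}\subset\mathcal{F}_{t_0}^{t_3}$ whenever $t_0\le t_1\le t_2\le t_3$, and these generate $\mathcal{F}$. Write $\mathcal{F}_s^\infty:=\sigma(\mathcal{F}_s^{s+t}:t\in\mathbb{T}^+)$ and $\mathcal{F}_{-\infty}^t:=\sigma(\mathcal{F}_{t-s}^t:s\in\mathbb{T}^+)$. $(\theta^t)_{t\in\mathbb{T}}$ is a group of measurable maps $\Omega\to\Omega$ with $\theta^\tau\mathcal{F}_s^t=\mathcal{F}_{s-\tau}^{t-\tau}$. $\mathbb{P}$ is a probability measure on $(\Omega,\mathcal{F})$ with $\theta^t_*\mathbb{P}=\mathbb{P}$ for all $t$, and such that for each $t$, $\mathcal{F}_{-\infty}^t$ and $\mathcal{F}_t^\infty$ are $\mathbb{P}$-independent. $(X,d)$ is a separable metric space which is a Borel subset of its $d$-completion; $B_\delta(x)$ is the open $\delta$-ball and $\Delta_A:=\{(x,x):x\in A\}$. $\varphi=(\varphi(t,\omega))_{t\in\mathbb{T}^+,\omega\in\Omega}$ is a family of continuous maps $X\to X$ such that (a) $\omega\mapsto\varphi(t,\omega)x$ is $(\mathcal{F}_0^t,\mathcal{B}(X))$-measurable for each $t,x$; (b)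 $\varphi(0,\omega)=\mathrm{id}_X$; (c) $\varphi(s+t,\omega)=\varphi(t,\theta^s\omega)\circ\varphi(s,\omega)$; (d) if $t_n\downarrow t$ in $\mathbb{T}^+$ and $x_n\to x$ in $X$ then $\varphi(t_n,\omega)x_n\to\varphi(t,\omega)x$ for all $\omega$. The Markov transition probabilities are $\varphi_x^t(A):=\mathbb{P}(\omega:\varphi(t,\omega)x\in A)$; a probability measure $\rho$ on $X$ is stationary if $\rho(A)=\int\varphi_x^t(A)\,\rho(dx)$ for all $t,A$, and an ergodic probability measure of $(\varphi_x^t)$ is an ergodic stationary measure. Definitions. A set $A\subset X$ contracts under $\omega$ if $\mathrm{diam}(\varphi(t,\omega)A)\to0$ as $t\to\infty$. $x$ is asymptotically stable under $\omega$ if some neighbourhood of $x$ contracts under $\omega$. $\varphi$ is stable with respect to $\rho$ if $\mathbb{P}(\omega:\exists$ open $U$ with $U\cap\mathrm{supp}\,\rho\neq\emptyset$ that contracts under $\omega)>0$. An open set $U$ is $\sigma$-contracting under $\omega$ if $U=\bigcup_i U_i$ for an increasing sequence of open sets $U_i$ each contracting under $\omega$. $\varphi$ is $\rho$-almost everywhere stably synchronising if for $\mathbb{P}$-a.e. $\omega$ there is an open set $U$ with $\rho(U)=1$ that is $\sigma$-contracting under $\omega$. For $x,y,p\in X$, $(x,y)$ is contractible towards $p$ if for every $\varepsilon>0$, $\mathbb{P}(\omega:\exists t\in\mathbb{T}^+,\ \varphi(t,\omega)x,\varphi(t,\omega)y\in B_\varepsilon(p))>0$; $\mathfrak{C}_p\subset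 X\times X$ is the set of such pairs. For $A\subset X$, $(x,y)$ is contractible towards $A$ if for every neighbourhood $V$ of $\Delta_A$ in $X\times X$, $\mathbb{P}(\omega:\exists t\in\mathbb{T}^+,\ (\varphi(t,\omega)x,\varphi(t,\omega)y)\in V)>0$; $\mathfrak{C}_A$ is the set of such pairs. A point $x\in\mathrm{supp}\,\rho$ is $\rho$-transitive if for every open $U$ with $\rho(U)>0$, $\mathbb{P}(\omega:\exists t\in\mathbb{T}^+,\ \varphi(t,\omega)x\in U)>0$; $A_\rho$ is the set of $\rho$-transitive points. A $\rho$-full-length rectangle is a set $A_1\times A_2\subset X\times X$ with $A_1,A_2$ Borel, $\rho(A_1)>0$, $\rho(A_2)=1$. *)

(* Defs.v *)
From HB Require Import structures.
From mathcomp Require Import all_boot all_order all_algebra.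
From mathcomp Require Import all_classical all_reals all_analysis.
Set Implicit Arguments. Unset Strict Implicit. Unset Printing Implicit Defensive.
Import Order.TTheory GRing.Theory Num.Theory.
Local Open Scope classical_set_scope.
Local Open Scope ring_scope.

Inductive timeset := TimeZ | TimeR.

Definition Tset {R : realType} (tt : timeset) : set R :=
  match tt with
  | TimeZ => [set t | exists z : int, t = z%:~R]
  | TimeR => setT
  end.

Definition Tplus {R : realType} (tt : timeset) : set R :=
  [set t | Tset tt t /\ 0 <= t].

Definition is_metric {R : realType} {X : Type} (d : X -> X -> R) : Prop :=
  (forall x y, 0 <= d x y) /\ (forall x y, d x y = 0 <-> x = y) /\
  (forall x y, d x y = d y x) /\ (forall x y z, d x z <= d x y + d y z).

Definition dball {R : realType} {X : Type} (d : X -> X -> R) (x : X) (e : R)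
  : set X := [set y | d x y < e].

Definition dopen {R : realType} {X : Type} (d : X -> X -> R) : set (set X) :=
  [set U | forall x, U x -> exists e, 0 < e /\ dball d x e `<=` U].

Definition dborel {R : realType} {X : Type} (d : X -> X -> R) : set (set X) :=
  <<s dopen d >>.

Definition dseparable {R : realType} {X : Type} (d : X -> X -> R) : Prop :=
  exists D : set X, countable D /\
    forall x e, 0 < e -> exists y, D y /\ d x y < e.

Definition dcauchy {R : realType} {X : Type} (d : X -> X -> R) (u : nat -> X) :=
  forall e, 0 < e -> exists N, forall m n, (N <= m)%N -> (N <= n)%N -> d (u m) (u n) < e.

Definition dconv {R : realType} {X : Type} (d : X -> X -> R) (u : nat -> X) (x : X) :=
  forall e, 0 < e -> exists N, forall n, (N <= n)%N -> d (u n) x < e.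

Definition dcomplete {R : realType} {X : Type} (d : X -> X -> R) : Prop :=
  forall u, dcauchy d u -> exists x, dconv d u x.

Definition borel_in_completion {R : realType} {X : Type} (d : X -> X -> R) : Prop :=
  exists (Y : Type) (dY : Y -> Y -> R) (e : X -> Y),
    is_metric dY /\ dcomplete dY /\ (forall x y, dY (e x) (e y) = d x y) /\
    dborel dY (range e).

Definition dcontinuous {R : realType} {X : Type} (d : X -> X -> R) (f : X -> X) :=
  forall x e, 0 < e -> exists del, 0 < del /\
    forall y, d x y < del -> d (f x) (f y) < e.

Definition XB {R : realType} {X : pointedType} (d : X -> X -> R) :=
  g_sigma_algebraType (dopen d).

Section OmegaDefs.
Context {R : realType} {dO : measure_display} {Omega : measurableType dO}.

Definition gen (G : set (set Omega)) : set (set Omega) := <<s G >>.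

Definition indep (P : probability Omega R) (G1 G2 : set (set Omega)) : Prop :=
  forall A B, G1 A -> G2 B -> P (A `&` B) = (P A * P B)%E.

(* positive probability, for possibly non-measurable sets (inner measure) *)
Definition Ppos (P : probability Omega R) (S : set Omega) : Prop :=
  exists B, measurable B /\ B `<=` S /\ (0 < P B)%E.
End OmegaDefs.

Section Dyn.
Context {R : realType} {dO : measure_display} {Omega : measurableType dO}
  {X : pointedType} (tt : timeset) (P : probability Omega R)
  (d : X -> X -> R) (phi : R -> Omega -> X -> X).

Definition supp (rho : set X -> \bar R) : set X :=
  [set x | forall e, 0 < e -> (0 < rho (dball d x e))%E].

Definition contracts (A : set X) (w : Omega) : Prop :=
  forall e, 0 < e -> exists t0, forall t, Tplus tt t -> t0 <= t ->
    forall x y, A x -> A y -> d (phi t w x) (phi t w y) <= e.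

Definition asympt_stable (x : X) (w : Omega) : Prop :=
  exists U, dopen d U /\ U x /\ contracts U w.

Definition stable_wrt (rho : set X -> \bar R) : Prop :=
  Ppos P [set w | exists U, dopen d U /\ U `&` supp rho !=set0 /\ contracts U w].

Definition sigma_contracting (U : set X) (w : Omega) : Prop :=
  dopen d U /\ exists Us : nat -> set X,
    (forall i, dopen d (Us i)) /\ (forall i, Us i `<=` Us i.+1) /\
    (forall i, contracts (Us i) w) /\ U = \bigcup_i Us i.

Definition ae_stably_sync (rho : set X -> \bar R) : Prop :=
  {ae P, forall w, exists U, dopen d U /\ rho U = 1%E /\ sigma_contracting U w}.

Definition Cp (p : X) : X -> X -> Prop := fun x y =>
  forall e, 0 < e -> Ppos P [set w | exists t, Tplus tt t /\
     d (phi t w x) p < e /\ d (phi t w y) p < e].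

Definition dopen2 (W : set (X * X)) : Prop :=
  forall a b, W (a, b) -> exists e, 0 < e /\
    forall a' b', d a a' < e -> d b b' < e -> W (a', b').

Definition diag (A : set X) : set (X * X) := [set z | A z.1 /\ z.2 = z.1].

Definition nbhd2_of (S V : set (X * X)) : Prop :=
  exists W, dopen2 W /\ S `<=` W /\ W `<=` V.

Definition CA (A : set X) : X -> X -> Prop := fun x y =>
  forall V, nbhd2_of (diag A) V ->
    Ppos P [set w | exists t, Tplus tt t /\ V (phi t w x, phi t w y)].

Definition Arho (rho : set X -> \bar R) : set X :=
  [set x | supp rho x /\ forall U, dopen d U -> (0 < rho U)%E ->
     Ppos P [set w | exists t, Tplus tt t /\ U (phi t w x)]].

Definition has_full_rect (rho : set X -> \bar R) (C : X -> X -> Prop) : Prop :=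
  exists A1 A2, dborel d A1 /\ dborel d A2 /\ (0 < rho A1)%E /\ rho A2 = 1%E /\
    forall x y, A1 x -> A2 y -> C x y.
End Dyn.

Definition transP {R : realType} {dO : measure_display} {Omega : measurableType dO}
  {X : Type} (P : probability Omega R) (phi : R -> Omega -> X -> X)
  (t : R) (x : X) (A : set X) : \bar R :=
  P [set w | A (phi t w x)].

Definition stationary {R : realType} {dO : measure_display} {Omega : measurableType dO}
  {X : pointedType} (tt : timeset) (P : probability Omega R) (d : X -> X -> R)
  (phi : R -> Omega -> X -> X) (rho : probability (XB d) R) : Prop :=
  forall t (A : set X), Tplus tt t -> dborel d A ->
    rho A = (\int[rho]_x transP P phi t x A)%E.

Definition ergodic {R : realType} {dO : measure_display} {Omega : measurableType dO}
  {X : pointedType} (tt : timeset) (P : probability Omega R) (d : X -> X -> R)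
  (phi : R -> Omega -> X -> X) (rho : probability (XB d) R) : Prop :=
  stationary tt P phi rho /\
  forall A : set X, dborel d A ->
    (forall t, Tplus tt t ->
       {ae rho, forall x : XB d, transP P phi t x A = (\1_A x)%:E}) ->
    rho A = 0%E \/ rho A = 1%E.

Definition RDS_memoryless {R : realType} {dO : measure_display} {Omega : measurableType dO}
  (tt : timeset) (F : R -> R -> set (set Omega)) (theta : R -> Omega -> Omega)
  (P : probability Omega R)
  {X : pointedType} (d : X -> X -> R) (phi : R -> Omega -> X -> X) : Prop :=
  let T := Tset tt in let Tp := Tplus tt in
  (forall a b, T a -> T b -> a <= b ->
     sigma_algebra setT (F a b) /\ F a b `<=` measurable) /\
  (forall t0 t1 t2 t3, T t0 -> T t1 -> T t2 -> T t3 ->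
     t0 <= t1 -> t1 <= t2 -> t2 <= t3 -> F t1 t2 `<=` F t0 t3) /\
  (@measurable _ Omega = gen [set A | exists a b, T a /\ T b /\ a <= b /\ F a b A]) /\
  (forall t, T t -> measurable_fun setT (theta t)) /\
  (theta 0 = id) /\
  (forall s t, T s -> T t -> theta (s + t) = theta s \o theta t) /\
  (forall tau a b, T tau -> T a -> T b -> a <= b ->
     forall B, F (a - tau) (b - tau) B <-> exists A, F a b A /\ B = theta tau @` A) /\
  (forall t, T t -> forall A, measurable A -> P (theta t @^-1` A) = P A) /\
  (forall t, T t ->
     indep P (gen [set A | exists s, Tp s /\ F (t - s) t A])
             (gen [set A | exists s, Tp s /\ F t (t + s) A])) /\
  is_metric d /\ dseparable d /\ borel_in_completion d /\
  (forall t w, Tp t -> dcontinuous d (phi t w)) /\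
  (forall t x, Tp t -> forall B, dborel d B -> F 0 t [set w | B (phi t w x)]) /\
  (forall w, phi 0 w = id) /\
  (forall s t w, Tp s -> Tp t -> phi (s + t) w = phi t (theta s w) \o phi s w) /\
  (forall w (ts : nat -> R) t (xs : nat -> X) x,
     (forall n, Tp (ts n)) -> Tp t -> (forall n, ts n.+1 <= ts n) ->
     (forall e, 0 < e -> exists N, forall n, (N <= n)%N -> `|ts n - t| < e) ->
     dconv d xs x -> dconv d (fun n => phi (ts n) w (xs n)) (phi t w x)).

(* Main.v *)
(** Let [h(x, y)] be the probability that some open set containing both [x] and
    [y] contracts. Contraction after time [t] implies contraction from time [0],
    so [h] evaluated along the two-point motion is dominated by the conditional
    probability of contraction given the past; by Levy's upward theorem it tends
    to [0] on the event that no such set contracts. Stability together with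
    contractibility towards the transitive points makes [h] positive on a
    rectangle, which by ergodicity may be taken to have two full sides. The set
    [h > 0] is a countable union of open rectangles on each of which [h] is
    bounded below, so by tightness of [rho] it is bounded below on a product of
    two compact sets of almost full measure, which the two-point motion, having
    both marginals equal to [rho], visits at each time with probability close to
    one. Hence [h = 1] almost everywhere, and by Fubini the contraction class of
    a typical point is an open set of full measure. Conversely a typical point is
    recurrent and almost every other point synchronises with it. *)
Require Import Defs.
From HB Require Import structures.
From mathcomp Require Import all_boot all_order all_algebra.
From mathcomp Require Import all_classical all_reals all_analysis.
From mathcomp Require Import lra measurable_realfun.
Set Implicit Arguments. Unset Strict Implicit. Unset Printing Implicit Defensive.
Import Order.TTheory GRing.Theory Num.Theory.
Import numFieldNormedType.Exports.
Local Open Scope classical_set_scope.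
Local Open Scope ring_scope.

(** * Metric spaces and regularity of Borel measures *)

(** Both points of the two-point motion feel the same noise, so nothing is known of its law at time
    [n] beyond the marginals. This is why pairs require compact sets, while for the one-point motion
    in [return_ae] level sets suffice by stationarity. Conditional probabilities never appear as
    such: the Markov property is an identity between product measures on past noise and future
    noise, and Levy's theorem is used as a convergence in probability, obtained by approximating a
    future event by events of finite horizon. Trajectories are only right continuous in time and
    open sets are uncountable in number, so events are rewritten with rational times, a dense
    sequence and base balls, and a pigeonhole over these countable families makes random choices
    deterministic. To obtain two full sides, the positive side of the rectangle grows to the points
    that may reach it, and the full side shrinks to the points that almost surely stay in it at
    rational times. *)

Section metric.
Context {R : realType} {X : Type} (d : X -> X -> R).
Hypothesis md : is_metric d.

Lemma is_metric_refl x : d x x = 0.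
Proof. by case: md => _ [h _]; exact/h. Qed.

Lemma is_metric_sym x y : d x y = d y x.
Proof. by case: md => _ [_ [h _]]. Qed.

Lemma is_metric_triangle y x z : d x z <= d x y + d y z.
Proof. by case: md => _ [_ [_ h]]. Qed.

Lemma dball_center x e : 0 < e -> dball d x e x.
Proof. by rewrite /dball /= is_metric_refl. Qed.

Lemma dball_open x e : dopen d (dball d x e).
Proof.
move=> y; rewrite /dball /= => xy; exists (e - d x y); rewrite subr_gt0.
split=> // z /= yz; have := is_metric_triangle y x z; lra.
Qed.

Lemma dopenT : dopen d setT.
Proof. by move=> x _; exists 1. Qed.

Lemma dopenI A B : dopen d A -> dopen d B -> dopen d (A `&` B).
Proof.
move=> oA oB x [/oA[a [a0 xa]] /oB[b [b0 xb]]].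
exists (Num.min a b); split; first by rewrite lt_min a0.
by move=> y; rewrite /dball /= lt_min => /andP[ya yb]; split; [exact: xa|exact: xb].
Qed.

Lemma dopen_bigcup I (D : set I) (A : I -> set X) :
  (forall i, D i -> dopen d (A i)) -> dopen d (\bigcup_(i in D) A i).
Proof.
move=> oA x [i Di /(oA _ Di)[e [e0 xe]]].
by exists e; split=> // y /xe; exists i.
Qed.

Lemma dopenU A B : dopen d A -> dopen d B -> dopen d (A `|` B).
Proof.
by move=> oA oB x [/oA|/oB] [e [e0 xe]]; exists e; split=> // y /xe; [left|right].
Qed.

Lemma dborel_open A : dopen d A -> dborel d A.
Proof. exact: sub_sigma_algebra. Qed.

End metric.

Section inner_closed.
Context {R : realType} {Y : Type} (d : Y -> Y -> R).
Hypothesis md : is_metric d.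

(** Closed exhaustion of an open set by distance to the complement; the quantifier over [z] replaces
    an infimum that would run over the empty set when [U] is everything. *)
Definition inner_closed (U : set Y) (n : nat) : set Y :=
  [set y | forall z, ~ U z -> n.+1%:R^-1 <= d y z].

Lemma inner_closedC U n : dopen d (~` inner_closed U n).
Proof.
move=> y /existsNP[z /not_implyP[Uz /negP]]; rewrite -ltNge => yz.
exists (n.+1%:R^-1 - d y z); split; first by rewrite subr_gt0.
move=> y' /= yy' /(_ z Uz); rewrite leNgt => /negP; apply.
move: (n.+1%:R^-1) yy' yz; rewrite /dball /= => r yy' yz.
by have := is_metric_triangle md y y' z; rewrite (is_metric_sym md y' y); lra.
Qed.

Lemma inner_closed_mono U m n : (m <= n)%N -> inner_closed U m `<=` inner_closed U n.
Proof.
move=> mn y h z /h; apply: le_trans.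
by rewrite lef_pV2 ?posrE// ler_nat.
Qed.

Lemma inner_closed_sub U n : inner_closed U n `<=` U.
Proof.
move=> y h; apply: contrapT => /h; rewrite is_metric_refl//.
by rewrite leNgt invr_gt0 ltr0n.
Qed.

(** The margin around [y] is split in half between the ball and the distance to the complement.
    Having a whole ball in one closed set is what [phi_jointly_measurable] uses. *)
Lemma inner_closed_ball {U y} : dopen d U -> U y ->
  exists n e, 0 < e /\ dball d y e `<=` inner_closed U n.
Proof.
move=> oU /oU[e [e0 ye]].
have [n ne] : exists n : nat, n.+1%:R^-1 < e / 2.
  by exists (Num.bound (e / 2)^-1); rewrite invf_plt ?posrE ?divr_gt0//;
    rewrite (lt_trans (archi_boundP _)) ?invr_ge0 ?divr_ge0 ?ltr_nat// ltW.
exists n, (e / 2); split; first by rewrite divr_gt0.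
move=> y'; rewrite /dball /= => yy' z Uz.
rewrite leNgt; apply/negP => y'z; apply: Uz; apply: ye; rewrite /dball /=.
move: (n.+1%:R^-1) ne y'z => r ne y'z.
by have := is_metric_triangle md y' y z; lra.
Qed.

Lemma inner_closed_bigcup U : dopen d U -> \bigcup_n inner_closed U n = U.
Proof.
move=> oU; apply/seteqP; split=> [y [n _ /inner_closed_sub//]|y Uy].
have [n [e [e0 h]]] := inner_closed_ball oU Uy.
by exists n => //; apply: h; exact: dball_center.
Qed.

End inner_closed.

Section closed_regularity.
Context {R : realType} {X : pointedType} (d : X -> X -> R) (rho : probability (XB d) R).
Context {Y : Type} (dY : Y -> Y -> R) (e : X -> Y).
Hypotheses (mdY : is_metric dY) (e_isom : forall x y, dY (e x) (e y) = d x y).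

Lemma isom_preimage_open U : dopen dY U -> dopen d (e @^-1` U).
Proof.
move=> oU x /= /oU[r [r0 h]]; exists r; split=> // y xy.
by apply: h; rewrite /dball /= e_isom.
Qed.

Lemma nonincreasing_measure_lt (V : (set (XB d))^nat) (r : R) :
  (forall n, measurable (V n)) -> (forall m n, (m <= n)%N -> V n `<=` V m) ->
  (rho (\bigcap_n V n) < r%:E)%E -> exists n, (rho (V n) < r%:E)%E.
Proof.
move=> mV ndV rr.
have cv : rho \o V @ \oo --> rho (\bigcap_n V n).
  apply: nonincreasing_cvg_mu => //.
  - by rewrite -ge0_fin_numE// fin_num_measure.
  - exact: bigcapT_measurable.
  - by move=> m n mn; exact/subsetPset/ndV.
apply: contrapT => /forallNP h; move: rr; rewrite ltNge => /negP; apply.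
rewrite -(cvg_lim _ cv)//; apply: lime_ge; first by apply/cvg_ex; eexists; exact: cv.
by apply: nearW => n /=; rewrite leNgt; exact/negP.
Qed.

(** The sets with this property include the open ones, by exhaustion with [inner_closed], and form a
    sigma-algebra. The isometry [e] lets a measure on [X] test sets of another space: it will be the
    identity for Borel sets of [X], and the embedding into the completion for the image of [X]. *)
Lemma closed_open_regularity B : dborel dY B -> forall r : R, 0 < r ->
  exists C V, [/\ dopen dY (~` C), dopen dY V, C `<=` B, B `<=` V &
    (rho (e @^-1` (V `\` C)) < r%:E)%E].
Proof.
move: B; apply: smallest_sub.
  split.
  - move=> r r0; exists set0, set0; split=> //.
    + by rewrite setC0; exact: dopenT.
    + by rewrite setD0 preimage_set0 measure0 lte_fin.
  - move=> A hA r /hA[C [V [oC oV CA AV rVC]]].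
    exists (~` V), (~` C); split=> //.
    + by rewrite setCK.
    + by rewrite setTD; exact: subsetC.
    + by rewrite setTD; exact: subsetC.
    + by rewrite setDE setCK setIC -setDE.
  - move=> A hA r r0.
    (* These errors sum to [r / 2], which leaves room for a strict inequality. All outer sets are
       united but only finitely many inner ones, so that [C N] stays closed; continuity from above
       then selects [N]. *)
    have hr n : 0 < r / 2 ^+ n.+2 by rewrite divr_gt0// exprn_gt0.
    have /choice[CV hCV] : forall n, exists CV : set Y * set Y,
      [/\ dopen dY (~` CV.1), dopen dY CV.2, CV.1 `<=` A n, A n `<=` CV.2 &
        (rho (e @^-1` (CV.2 `\` CV.1)) < (r / 2 ^+ n.+2)%:E)%E].
      by move=> n; have [C [V h]] := hA n _ (hr n); exists (C, V).
    pose V := \bigcup_n (CV n).2; pose C N := \bigcup_(n < N) (CV n).1.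
    have oV : dopen dY V by apply: dopen_bigcup => n _; have [] := hCV n.
    have oC N : dopen dY (~` C N).
      rewrite /C bigcup_mkord; apply: (big_ind (fun B => dopen dY (~` B))).
      - by rewrite setC0; exact: dopenT.
      - by move=> A1 A2; rewrite setCU; exact: dopenI.
      - by move=> i _; have [] := hCV i.
    have mVC N : measurable (e @^-1` (V `\` C N) : set (XB d)).
      rewrite setDE preimage_setI; apply: measurableI; apply: dborel_open;
        exact: isom_preimage_open.
    have [|||N hN] := @nonincreasing_measure_lt (fun N => e @^-1` (V `\` C N)) r.
    + exact: mVC.
    + move=> m n mn x [Vx Cx]; split=> //; apply: contra_not Cx => -[k /= km ?].
      by exists k => //=; exact: leq_trans mn.
    + apply: (@le_lt_trans _ _ (rho (\bigcup_n (e @^-1` ((CV n).2 `\` (CV n).1))))).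
        apply: le_measure; rewrite ?inE.
        * by apply: bigcapT_measurable => N; exact: mVC.
        * apply: bigcupT_measurable => n; rewrite setDE preimage_setI.
          apply: measurableI; apply: dborel_open; apply: isom_preimage_open;
            by have [] := hCV n.
        * move=> x h; have [[n _ Vx] _] := h 0%N I; exists n => //; split=> // Cx.
          by have [_] := h n.+1 I; apply; exists n => /=.
      apply: (@le_lt_trans _ _ (\sum_(n <oo) rho (e @^-1` ((CV n).2 `\` (CV n).1)))%E).
        apply: measure_sigma_subadditive => //.
        * move=> n; rewrite setDE preimage_setI; apply: measurableI;
            apply: dborel_open; apply: isom_preimage_open; by have [] := hCV n.
        * apply: bigcupT_measurable => n; rewrite setDE preimage_setI.
          apply: measurableI; apply: dborel_open; apply: isom_preimage_open;
            by have [] := hCV n.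
      apply: (@le_lt_trans _ _ (\sum_(n <oo) ((r / 2) / (2 ^ n.+1)%:R)%:E)%E).
        apply: lee_nneseries => // n _.
        have [_ _ _ _ /ltW] := hCV n; move=> /le_trans; apply.
        by rewrite lee_fin natrX -mulrA -invfM -exprS.
      apply: le_lt_trans (@epsilon_trick0 _ (r / 2) xpredT _) _.
        by rewrite divr_ge0 ?(ltW r0).
      by rewrite lte_fin; lra.
    exists (C N), V; split=> //.
    + by move=> y [n _ yn]; exists n => //; have [_ _ + _ _] := hCV n; apply.
    + by move=> y [n _ yn]; exists n => //; have [_ _ _ + _] := hCV n; apply.
move=> U oU r r0.
have mU : measurable (e @^-1` U : set (XB d)).
  by apply: dborel_open; exact: isom_preimage_open.
have mC n : measurable (e @^-1` (U `\` inner_closed dY U n) : set (XB d)).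
  rewrite setDE preimage_setI; apply: measurableI => //.
  by apply: dborel_open; apply: isom_preimage_open; exact: inner_closedC.
have [|||n hn] := @nonincreasing_measure_lt
    (fun n => e @^-1` (U `\` inner_closed dY U n)) r.
- exact: mC.
- move=> m n mn x [Ux Cx]; split=> //; apply: contra_not Cx.
  exact: inner_closed_mono.
- rewrite (_ : \bigcap_n _ = set0) ?measure0 ?lte_fin//.
  rewrite -subset0 => x h; have [Ux _] := h 0%N I.
  have [n _ Cx] : (\bigcup_n inner_closed dY U n) (e x).
    by rewrite inner_closed_bigcup.
  by have [_] := h n I; apply.
exists (inner_closed dY U n), U; split=> //; first exact: inner_closedC.
exact: inner_closed_sub.
Qed.

End closed_regularity.

(** * Sequential compactness and tightness *)

Section sequential_compactness.
Context {R : realType} {X : Type} (d : X -> X -> R).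
Hypothesis md : is_metric d.

Definition seq_compact (K : set X) : Prop :=
  forall x : nat -> X, (forall n, K (x n)) ->
    exists s : nat -> nat, {homo s : m n / (m < n)%N} /\
      exists l, K l /\ dconv d (x \o s) l.

Lemma inv_succ_lt (e : R) : 0 < e -> exists n : nat, n.+1%:R^-1 < e.
Proof.
move=> e0; exists (Num.bound e^-1); rewrite invf_plt ?posrE//.
by rewrite (lt_trans (archi_boundP _)) ?invr_ge0 ?ltr_nat// ltW.
Qed.

Lemma homo_ltn_ge (s : nat -> nat) : {homo s : m n / (m < n)%N} ->
  forall n, (n <= s n)%N.
Proof. by move=> sS; elim=> // n /leq_ltn_trans; apply; exact: sS. Qed.

(* An ultrafilter selects, at each scale, one ball of the finite cover. *)
Lemma totally_bounded_cauchy_subseq (u : nat -> X) (x : nat -> X) :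
  (forall k, exists N, forall n, exists2 j, (j < N)%N & d (u j) (x n) < k.+1%:R^-1) ->
  exists s : nat -> nat, {homo s : m n / (m < n)%N} /\ dcauchy d (x \o s).
Proof.
move=> tb.
have [G [GU Goo]] := @ultraFilterLemma _ \oo _.
have hG k : exists j, G [set n | d (u j) (x n) < k.+1%:R^-1].
  have [N hN] := tb k; apply: contrapT => /forallNP nG.
  have GC j : G (~` [set n | d (u j) (x n) < k.+1%:R^-1]).
    by have [|//] := in_ultra_setVsetC [set n | d (u j) (x n) < k.+1%:R^-1] GU; move/(nG j).
  have GN M : G [set n | forall j, (j < M)%N -> ~ d (u j) (x n) < k.+1%:R^-1].
    elim: M => [|M IH]; first by apply: filterS filterT.
    apply: filterS (filterI IH (GC M)) => n [/= h1 h2] j.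
    by rewrite ltnS leq_eqVlt => /orP[/eqP->//|/h1].
  have [n hn] := filter_ex (GN N).
  by have [j /hn] := hN n.
have [j hj] := choice hG.
have Gk k : G [set n | forall i, (i <= k)%N -> d (u (j i)) (x n) < i.+1%:R^-1].
  elim: k => [|k IH].
    by apply: filterS (hj 0%N) => n /= h i; rewrite leqn0 => /eqP ->.
  apply: filterS (filterI IH (hj k.+1)) => n [/= h1 h2] i.
  by rewrite leq_eqVlt => /orP[/eqP->//|]; rewrite ltnS => /h1.
(* [G] contains all tails, so an index exists beyond the previous one [km.2] and close to the
   selected centres at every scale up to [km.1]. *)
have /choice[f hf] : forall km : nat * nat, exists n, (km.2 < n)%N /\
    forall i, (i <= km.1)%N -> d (u (j i)) (x n) < i.+1%:R^-1.
  move=> [k m]; apply: (@filter_ex _ G); apply: filterI (Gk k).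
  by apply: Goo; exists m.+1.
pose s := fix s k := if k is k'.+1 then f (k, s k') else f (0%N, 0%N).
have sS k : (s k < s k.+1)%N by have [] := hf (k.+1, s k).
have sd k i : (i <= k)%N -> d (u (j i)) (x (s k)) < i.+1%:R^-1.
  by case: k => [|k]; [apply: (hf (0%N, 0%N)).2|apply: (hf (k.+1, s k)).2].
exists s; split.
  by apply: homo_ltn => // a b c; exact: ltn_trans.
move=> e e0; have [k ke] := inv_succ_lt (divr_gt0 e0 (ltr0n _ 2)).
exists k => m n km kn /=.
have := is_metric_triangle md (u (j k)) (x (s m)) (x (s n)).
have := sd m k km; have := sd n k kn; rewrite (is_metric_sym md _ (u (j k))).
by move: (k.+1%:R^-1) ke => r; lra.
Qed.

(** Finite subcover of a product by open rectangles. Pairs missed by the first [N] rectangles would,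
    after extraction in one factor and then in the other, converge to a point of some rectangle and
    hence enter it. *)
Lemma seq_compact_tube (K1 K2 : set X) (G H : nat -> set X) :
  seq_compact K1 -> seq_compact K2 ->
  (forall k, dopen d (G k)) -> (forall k, dopen d (H k)) ->
  (forall x y, K1 x -> K2 y -> exists k, G k x /\ H k y) ->
  exists N, forall x y, K1 x -> K2 y -> exists2 k, (k < N)%N & G k x /\ H k y.
Proof.
move=> c1 c2 oG oH cov; apply: contrapT => /forallNP h.
have /choice[xy hxy] : forall N, exists xy : X * X,
    [/\ K1 xy.1, K2 xy.2 & forall k, (k < N)%N -> ~ (G k xy.1 /\ H k xy.2)].
  move=> N; apply: contrapT => /forallNP hN; apply: (h N) => x y Kx Ky.
  apply: contrapT => hk; apply: (hN (x, y)); split=> // k kN GH.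
  by apply: hk; exists k.
have [s [sS [a [Ka xa]]]] := c1 (fst \o xy) (fun n => let: And3 h _ _ := hxy n in h).
have [t [tS [b [Kb yb]]]] := c2 (snd \o xy \o s) (fun n => let: And3 _ h _ := hxy (s n) in h).
have [k [/oG[e [e0 Ge]] /oH[e' [e'0 He]]]] := cov a b Ka Kb.
have [n1 hn1] := xa e e0; have [n2 hn2] := yb e' e'0.
(* Beyond [k], so that rectangle [k] is among those avoided by the pair of index [s (t n)], which is
   at least [n]. *)
pose n := maxn (maxn n1 n2) k.+1.
have [_ _ /(_ k)] := hxy (s (t n)); apply.
  apply: leq_trans (homo_ltn_ge sS _).
  by apply: leq_trans (homo_ltn_ge tS _); rewrite leq_max leqnn orbT.
split; [apply: Ge|apply: He]; rewrite /dball /= is_metric_sym//.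
  by apply: hn1; apply: leq_trans (homo_ltn_ge tS _); rewrite /n -maxnA leq_maxl.
apply: hn2; apply: (@leq_trans n); first by rewrite /n maxnAC leq_maxr.
exact: leqnn.
Qed.

End sequential_compactness.

Lemma countable_enumeration (T : pointedType) (D : set T) :
  countable D -> D !=set0 ->
  exists u : nat -> T, (forall n, D (u n)) /\ forall x, D x -> exists n, u n = x.
Proof.
move=> /countable_injP[f injf] [x0 Dx0].
exists (fun n => xget x0 [set x | D x /\ f x = n]); split.
  by move=> n; case: xgetP => [x _ []|].
move=> x Dx; exists (f x); case: xgetP => [y _ [Dy fyx]|/(_ x)]; last by case.
by apply: injf => //; rewrite inE.
Qed.

Section tightness.
Context {R : realType} {X : pointedType} (d : X -> X -> R) (rho : probability (XB d) R).
Hypotheses (md : is_metric d) (sd : dseparable d).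

Lemma separable_seq : exists u : nat -> X, forall x e, 0 < e -> exists n, d (u n) x < e.
Proof.
have [D [cD hD]] := sd.
have [|u [_ hu]] := @countable_enumeration X D cD.
  by have [y [Dy _]] := hD point 1 ltr01; exists y.
exists u => x e e0; have [y [/hu[n <-] xy]] := hD x e e0.
by exists n; rewrite is_metric_sym.
Qed.

Definition dcball (x : X) (e : R) : set X := [set y | d x y <= e].

Lemma dcballC x e : dopen d (~` dcball x e).
Proof.
move=> y; rewrite /dcball /= => /negP; rewrite -ltNge => xy.
exists (d x y - e); rewrite subr_gt0; split=> // z.
rewrite /dball /= => yz xz.
by have := is_metric_triangle md z x y; rewrite (is_metric_sym md z y); lra.
Qed.

Lemma closed_limit (K : set X) (x : nat -> X) l :
  dopen d (~` K) -> (forall n, K (x n)) -> dconv d x l -> K l.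
Proof.
move=> oK Kx xl; apply: contrapT => /oK[e [e0 h]].
have [N hN] := xl e e0; apply: (h (x N)) (Kx N).
by rewrite /dball /= is_metric_sym//; exact: hN.
Qed.

Lemma dborel_closed (K : set X) : dopen d (~` K) -> @measurable _ (XB d) K.
Proof. by move=> /dborel_open mK; rewrite -(setCK K); exact: measurableC. Qed.

(** Ulam's theorem. Cauchy sequences converge only in the completion, and a closed set [C2] inside
    the image of [X] brings their limits back. Three losses of at most [r / 4] occur: inside [A] for
    [C1], for [C2], and for total boundedness. *)
Lemma tightness A : borel_in_completion d -> dborel d A -> forall r : R, 0 < r ->
  exists K, [/\ K `<=` A, dborel d K, seq_compact d K & (rho (A `\` K) < r%:E)%E].
Proof.
move=> [Y [dY [e [mdY [cY [isoe be]]]]]] mA r r0.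
have r3 : 0 < r / 4 by rewrite divr_gt0.
have [u hu] := separable_seq.
have [C1 [V1 [oC1 oV1 CA AV rV1]]] :=
  @closed_open_regularity _ _ d rho _ d id md (fun _ _ => erefl) A mA _ r3.
have [C2 [V2 [oC2 oV2 Ce eV rV2]]] :=
  @closed_open_regularity _ _ d rho _ dY e mdY isoe _ be _ r3.
(* Closed balls make the intersection closed; the radius [1/(k+2)] gives the strict bound [1/(k+1)]
   wanted for the Cauchy subsequence. *)
pose B k N := \bigcup_(j < N) dcball (u j) (k.+2%:R^-1).
have oB k N : dopen d (~` B k N).
  rewrite /B bigcup_mkord; apply: (big_ind (fun B => dopen d (~` B))).
  - by rewrite setC0; exact: dopenT.
  - by move=> B1 B2; rewrite setCU; exact: dopenI.
  - by move=> i _; exact: dcballC.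
have mBC k N : @measurable _ (XB d) (~` B k N) by apply: dborel_open; exact: oB.
have h2 k : 0 < r / 4 / 2 ^+ k.+1 by rewrite divr_gt0// exprn_gt0.
have /choice[N hN] : forall k, exists N, (rho (~` B k N) < (r / 4 / 2 ^+ k.+1)%:E)%E.
  move=> k; apply: (@nonincreasing_measure_lt _ _ d rho (fun N => ~` B k N)).
  - exact: mBC.
  - by move=> m n mn; apply: subsetC => x [j /= jm ?]; exists j => //=; exact: leq_trans mn.
  - rewrite (_ : \bigcap_n _ = set0) ?measure0 ?lte_fin//.
    rewrite -subset0 => x h.
    have [n /ltW xn] := hu x k.+2%:R^-1 ltac:(by rewrite invr_gt0).
    by apply: (h n.+1 I); exists n => /=.
pose K3 := \bigcap_k B k (N k).
have oK3 : dopen d (~` K3) by rewrite setC_bigcap; exact: dopen_bigcup.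
pose K2 := e @^-1` C2.
have oK2 : dopen d (~` K2) by rewrite preimage_setC; exact: isom_preimage_open oC2.
pose K := C1 `&` K2 `&` K3.
have oK : dopen d (~` K) by rewrite !setCI; apply: dopenU => //; exact: dopenU.
exists K; split.
- by move=> x [[/CA]].
- exact: dborel_closed.
- move=> x Kx.
  have [|s [sS cs]] := @totally_bounded_cauchy_subseq _ _ _ md u x.
    move=> k; exists (N k) => n; have [_ /(_ k I)[j /= jN xj]] := Kx n.
    exists j => //; apply: le_lt_trans xj _.
    by rewrite ltf_pV2 ?posrE// ltr_nat.
  exists s; split=> //.
  have [y ey] : exists y, dconv dY (e \o x \o s) y.
    apply: cY => a a0; have [M hM] := cs a a0; exists M => m n mM nM /=.
    by rewrite isoe; exact: hM.
  have C2y : C2 y.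
    apply: contrapT => /oC2[a [a0 ha]]; have [M hM] := ey a a0.
    have [[_ C2x] _] := Kx (s M); apply: ha C2x.
    by rewrite /dball /= is_metric_sym//; exact: hM.
  have [l _ el] := Ce y C2y; exists l.
  have xl : dconv d (x \o s) l.
    move=> a a0; have [M hM] := ey a a0; exists M => n nM.
    by rewrite -isoe el; exact: hM.
  split=> //; apply: closed_limit xl => //.
  by move=> n /=; exact: Kx.
- have mC1 : @measurable _ (XB d) (A `\` C1).
    by apply: measurableD => //; exact: dborel_closed.
  have mK2 : @measurable _ (XB d) (~` K2) by apply: dborel_open.
  have mK3 : @measurable _ (XB d) (~` K3) by apply: dborel_open.
  have mK : @measurable _ (XB d) (A `\` K).
    by apply: measurableD => //; exact: dborel_closed.
  have sub : A `\` K `<=` (A `\` C1) `|` (~` K2) `|` (~` K3).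
    move=> x [Ax Kx]; apply: contrapT => /not_orP[/not_orP[h1 h2'] h3].
    apply: Kx; split; [split|]; apply: contrapT => // h; exact: h1.
  have b1 : (rho (A `\` C1) <= (r / 4)%:E)%E.
    apply: le_trans (ltW rV1); apply: le_measure; rewrite ?inE//.
      apply: measurableD; last exact: dborel_closed.
      exact: dborel_open.
    by apply: setSD.
  have b2 : (rho (~` K2) <= (r / 4)%:E)%E.
    apply: le_trans (ltW rV2); apply: le_measure; rewrite ?inE//.
      rewrite setDE preimage_setI; apply: measurableI; apply: dborel_open;
        exact: (isom_preimage_open isoe).
    by move=> x K2x; split=> //; apply: eV; exists x.
  have b3 : (rho (~` K3) <= (r / 4)%:E)%E.
    apply: (@le_trans _ _ (\sum_(k <oo) rho (~` B k (N k)))%E).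
      by apply: measure_sigma_subadditive => //; rewrite /K3 setC_bigcap.
    apply: le_trans (@epsilon_trick0 _ (r / 4) xpredT (ltW r3)).
    apply: lee_nneseries => // k _.
    by rewrite natrX ltW.
  apply: (@le_lt_trans _ _ (rho (A `\` C1) + rho (~` K2) + rho (~` K3))%E).
    apply: (@le_trans _ _ (rho ((A `\` C1) `|` (~` K2) `|` (~` K3)))).
      by apply: le_measure; rewrite ?inE//; do 2 apply: measurableU => //.
    apply: le_trans (measureU2 _ _ _) _ => //; first exact: measurableU.
    by apply: leeD => //; exact: measureU2.
  apply: (@le_lt_trans _ _ ((r / 4)%:E + (r / 4)%:E + (r / 4)%:E)%E).
    by apply: leeD => //; exact: leeD.
  by rewrite -!EFinD lte_fin; lra.
Qed.

End tightness.

(** * Countable operations, rational times and base balls *)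

Section countable_operations.
Context {dT : measure_display} {T : measurableType dT}.

Lemma countable_bigcup_measurable (I : pointedType) (D : set I) (A : I -> set T) :
  countable D -> (forall i, D i -> measurable (A i)) ->
  measurable (\bigcup_(i in D) A i).
Proof.
move=> cD mA; have [->|/set0P D0] := eqVneq D set0; first by rewrite bigcup_set0.
have [u [Du uD]] := countable_enumeration cD D0.
rewrite (_ : \bigcup_(i in D) A i = \bigcup_n A (u n)).
  by apply: bigcupT_measurable => n; exact/mA/Du.
apply/seteqP; split=> [x [i /uD[n <-] ?]|x [n _ ?]]; first by exists n.
by exists (u n).
Qed.

Lemma countable_bigcap_measurable (I : pointedType) (D : set I) (A : I -> set T) :
  countable D -> (forall i, D i -> measurable (A i)) ->
  measurable (\bigcap_(i in D) A i).
Proof.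
move=> cD mA; rewrite -(setCK (\bigcap_(i in D) A i)) setC_bigcap.
apply: measurableC; apply: countable_bigcup_measurable => // i Di.
exact/measurableC/mA.
Qed.

(** Countable pigeonhole. It replaces a time, a base ball or a level that depends on the outcome by
    a fixed one, at the price of a smaller but still positive probability. *)
Lemma countable_bigcup_measure_gt0 (R : realType) (mu : {measure set T -> \bar R})
    (I : pointedType) (D : set I) (A : I -> set T) (B : set T) :
  countable D -> (forall i, D i -> measurable (A i)) -> measurable B ->
  B `<=` \bigcup_(i in D) A i -> (0 < mu B)%E -> exists2 i, D i & (0 < mu (A i))%E.
Proof.
move=> cD mA mB BA; apply: contraPP => /forall2NP h.
have A0 i : D i -> mu (A i) = 0%E.
  by move=> Di; have [//|/negP] := h i; rewrite -leNgt measure_le0 => /eqP.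
apply/negP; rewrite -leNgt measure_le0; apply/eqP/negligibleP => //.
apply: negligibleS BA _; have [->|/set0P D0] := eqVneq D set0.
  by rewrite bigcup_set0; exact: negligible_set0.
have [u [Du uD]] := countable_enumeration cD D0.
apply: (@negligibleS _ _ _ _ (\bigcup_n A (u n))).
  by move=> x [i /uD[n <-] ?]; exists n.
by apply: negligible_bigcup => n; apply/negligibleP; [exact/mA/Du|exact/A0/Du].
Qed.

End countable_operations.

(** A countable stand-in for [Tplus], closed under addition and dense in it from the right; for
    integer time it is all of [Tplus]. *)
Definition rtime {R : realType} (tt : timeset) : set R :=
  [set t | Tplus tt t /\ exists q : rat, t = ratr q].

Section rational_times.
Context {R : realType} (tt : timeset).
Local Notation Tp := (@Tplus R tt).
Local Notation rtime := (@rtime R tt).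

Lemma rtimeP q : rtime q -> Tp q. Proof. by case. Qed.

Lemma rtime_countable : countable rtime.
Proof.
apply: (@sub_countable _ _ _ (range (@ratr R))).
  by apply: subset_card_le => t [_ [q ->]]; exists q.
exact: card_le_trans (card_image_le _ _) (countableP _).
Qed.

Lemma Tplus_nat n : Tp n%:R.
Proof. by split; [case: tt => //; exists n|exact: ler0n]. Qed.

Lemma rtime_nat n : rtime n%:R.
Proof. by split; [exact: Tplus_nat|exists n%:R; rewrite ratr_nat]. Qed.

Lemma Tplus_add s t : Tp s -> Tp t -> Tp (s + t).
Proof.
move=> [Ts s0] [Tt t0]; split; last exact: addr_ge0.
by case: tt Ts Tt => // -[z ->] [z' ->]; exists (z + z'); rewrite intrD.
Qed.

Lemma rtime_add s t : rtime s -> rtime t -> rtime (s + t).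
Proof.
move=> [Ts [a sa]] [Tt [b tb]]; split; first exact: Tplus_add Ts Tt.
by exists (a + b); rewrite rmorphD sa tb.
Qed.

Lemma rtime_approx t : Tp t -> exists q : nat -> R,
  [/\ forall n, rtime (q n), forall n, q n.+1 <= q n, forall n, t <= q n &
    forall e, 0 < e -> exists N, forall n, (N <= n)%N -> `|q n - t| < e].
Proof.
move=> Tt; case: (pselect (rtime t)) => [rt|nrt].
  by exists (fun=> t); split=> // e e0; exists 0%N => n _; rewrite subrr normr0.
have ttR : tt = TimeR.
  case: tt Tt nrt => // -[[z zt] t0] nrt; exfalso; apply: nrt.
  by split; [split; [exists z|]|exists z%:~R; rewrite ratr_int].
have lt_succ n : t + n.+2%:R^-1 < t + n.+1%:R^-1 :> R.
  by rewrite ltrD2l ltf_pV2 ?posrE// ltr_nat.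
(* Consecutive windows meet only at an endpoint, so the chosen times decrease, as right continuity
   of the trajectories demands. *)
have /choice[q hq] : forall n, exists q : rat,
    t + n.+2%:R^-1 < ratr q < t + n.+1%:R^-1.
  move=> n; have [q] := rat_in_itvoo (lt_succ n).
  by rewrite in_itv/=; exists q.
have tq n : t < ratr (q n).
  have /andP[+ _] := hq n; apply: lt_trans.
  by rewrite ltrDl invr_gt0.
exists (fun n => ratr (q n)); split.
- move=> n; split; last by exists (q n).
  by split; [rewrite ttR|rewrite (le_trans _ (ltW (tq n)))//; case: Tt].
- move=> n; have /andP[/ltW h _] := hq n; have /andP[_ /ltW h'] := hq n.+1.
  exact: le_trans h' h.
- by move=> n; exact/ltW/tq.
- move=> e e0; have [N Ne] := inv_succ_lt e0; exists N => n Nn.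
  rewrite ger0_norm ?subr_ge0 ?(ltW (tq n))//.
  have /andP[_ h] := hq n; rewrite ltrBlDl (lt_trans h)// ltrD2l.
  by rewrite (le_lt_trans _ Ne)// lef_pV2 ?posrE// ler_nat.
Qed.

End rational_times.

Section base.
Context {R : realType} {X : pointedType} (d : X -> X -> R) (u : nat -> X).
Hypotheses (md : is_metric d) (hu : forall x e, 0 < e -> exists n, d (u n) x < e).

Definition base_ball (i : nat * nat) : set X := dball d (u i.1) i.2.+1%:R^-1.

Lemma base_ball_open i : dopen d (base_ball i).
Proof. exact: dball_open. Qed.

Lemma base_ball_measurable i : @measurable _ (XB d) (base_ball i).
Proof. by apply: dborel_open; exact: base_ball_open. Qed.

Lemma base_ballP U x : dopen d U -> U x ->
  exists i, base_ball i x /\ base_ball i `<=` U.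
Proof.
move=> oU /oU[e [e0 xU]]; have [n ne] := inv_succ_lt (divr_gt0 e0 (ltr0n _ 2)).
have [k kx] := hu x (e := n.+1%:R^-1) ltac:(by rewrite invr_gt0).
exists (k, n); split=> // y; rewrite /base_ball /dball /= => ky; apply: xU.
have := is_metric_triangle md (u k) x y; rewrite (is_metric_sym md x (u k)).
by rewrite /dball /=; move: (n.+1%:R^-1) ne kx ky => r; lra.
Qed.

Lemma dense_open U x e : dopen d U -> U x -> 0 < e ->
  exists k, U (u k) /\ d (u k) x < e.
Proof.
move=> oU /oU[r [r0 xU]] e0.
have [k] := hu x (e := Num.min r e) ltac:(by rewrite lt_min r0).
rewrite lt_min => /andP[kr ke]; exists k; split=> //; apply: xU.
by rewrite /dball /= is_metric_sym.
Qed.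

(** The countable base makes an open set of pairs a countable union of rectangles, hence a member of
    the product sigma-algebra. *)
Lemma dopen2_measurable W : dopen2 d W ->
  @measurable _ (XB d * XB d)%type W.
Proof.
move=> oW.
rewrite (_ : W = \bigcup_(k in [set k | base_ball k.1 `*` base_ball k.2 `<=` W])
    (base_ball k.1 `*` base_ball k.2)).
  apply: countable_bigcup_measurable => [|k _]; first exact: countableP.
  by apply: measurableX; exact: base_ball_measurable.
apply/seteqP; split=> [[a b] Wab|z [k kW]]; last exact: kW.
have [e [e0 he]] := oW a b Wab.
have [i [ia iW]] := base_ballP (@dball_open _ _ _ md a e) (dball_center md _ e0).
have [j [jb jW]] := base_ballP (@dball_open _ _ _ md b e) (dball_center md _ e0).
exists (i, j) => //= -[a' b'] /= [ia' jb'].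
by apply: he; [exact: iW|exact: jW].
Qed.

Lemma dist_gt_open2 r : dopen2 d [set z | r < d z.1 z.2].
Proof.
move=> a b /= rab; exists ((d a b - r) / 2).
rewrite divr_gt0 ?subr_gt0//; split=> // a' b' aa' bb'.
have := is_metric_triangle md a' a b; have := is_metric_triangle md b' a' b.
by rewrite (is_metric_sym md b' b); lra.
Qed.

Lemma dist_le_measurable r : @measurable _ (XB d * XB d)%type [set z | d z.1 z.2 <= r].
Proof.
rewrite (_ : [set z | _] = ~` [set z | r < d z.1 z.2]).
  by apply: measurableC; apply: dopen2_measurable; exact: dist_gt_open2.
by apply/seteqP; split=> z /=; rewrite leNgt => /negP.
Qed.

Lemma dcontinuous_preimage_open f U : dcontinuous d f -> dopen d U ->
  dopen d (f @^-1` U).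
Proof.
move=> cf oU x /= /oU[e [e0 h]]; have [r [r0 hr]] := cf x e e0.
by exists r; split=> // y xy; apply: h; exact: hr.
Qed.

End base.

(** * Markov property of the memoryless noise *)

Section sub_probability.
Context {R : realType} {dO : measure_display} {Omega : measurableType dO}
  (P : probability Omega R) (G : set (set Omega)).
Hypothesis hG : G `<=` measurable.
Local Notation OmG := (g_sigma_algebraType G).

Lemma sub_sigma_measurable : <<s G >> `<=` @measurable _ Omega.
Proof. by apply: smallest_sub => //; exact: sigma_algebra_measurable. Qed.

Lemma sub_id_measurable : measurable_fun [set: Omega] (id : Omega -> OmG).
Proof. by move=> _ A mA; rewrite setTI; exact: sub_sigma_measurable. Qed.

Definition sub_id : {mfun Omega >-> OmG} := mfun_Sub (mem_set sub_id_measurable).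

(** The restriction of [P] to a smaller sigma-algebra, as an image under the identity; its values
    are those of [P] by conversion. *)
Definition sub_prob : probability OmG R := distribution P sub_id.

End sub_probability.

Section random_dynamical_system.
Context {R : realType} {tt : timeset} {dO : measure_display}
  {Omega : measurableType dO} {F : R -> R -> set (set Omega)}
  {theta : R -> Omega -> Omega} {P : probability Omega R}
  {X : pointedType} {d : X -> X -> R} {phi : R -> Omega -> X -> X}.
Hypothesis rds : RDS_memoryless tt F theta P d phi.
Local Notation Tp := (@Tplus R tt).

(** Generators of the noise after time zero. This sigma-algebra carries the noise factor of all
    product measures, because its events become independent of the past after a shift. *)
Definition future : set (set Omega) := [set A | exists s, Tplus tt s /\ F 0 s A].
Local Notation Om0 := (g_sigma_algebraType future).
Local Notation Omt t := (g_sigma_algebraType (F 0 t)).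

Lemma Tset0 : Tset tt (0 : R).
Proof. by have [] := @Tplus_nat R tt 0. Qed.

Lemma F_sigma_algebra t : Tp t -> sigma_algebra setT (F 0 t).
Proof. by case: rds => h _ [Tt t0]; have [] := h 0 t Tset0 Tt t0. Qed.

Lemma F_sub t : Tp t -> F 0 t `<=` measurable.
Proof. by case: rds => h _ [Tt t0]; have [] := h 0 t Tset0 Tt t0. Qed.

Lemma F_mono s t : Tp s -> Tp t -> s <= t -> F 0 s `<=` F 0 t.
Proof.
move=> [Ts s0] [Tt t0] st; case: rds => _ [h _].
exact: h Tset0 Tset0 Ts Tt _ _ st.
Qed.

Lemma F_measurableE t : Tp t -> @measurable _ (Omt t) = F 0 t.
Proof. by move=> Tt; exact/measurable_g_measurableTypeE/F_sigma_algebra. Qed.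

Lemma F_future t : Tp t -> F 0 t `<=` @measurable _ Om0.
Proof. by move=> Tt A FA; apply: sub_sigma_algebra; exists t. Qed.

Lemma future_sub : future `<=` measurable.
Proof. by move=> A [s [Ts]]; exact: F_sub. Qed.

Definition P0 : probability Om0 R := sub_prob P future_sub.
Definition Pt t (Tt : Tp t) : probability (Omt t) R := sub_prob P (F_sub Tt).

Lemma theta_measurable t : Tp t -> measurable_fun setT (theta t).
Proof. by move=> [Tt _]; case: rds => _ [_ [_ [h _]]]; exact: h. Qed.

Lemma future_measurable (A : set Omega) : @measurable _ Om0 A -> measurable A.
Proof. exact: (sub_sigma_measurable future_sub). Qed.

Lemma theta_inv t : Tset tt t -> theta (- t) \o theta t = id.
Proof.
move=> Tt; case: rds => _ [_ [_ [_ [th0 [h _]]]]].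
rewrite -h// ?addNr//.
by case: tt Tt => // -[z ->]; exists (- z); rewrite intrN.
Qed.

(** The preimage under [theta t] of a future event belongs to the noise after [t], which is
    independent of the noise up to [t]; invariance of [P] then removes the shift from its
    probability. *)
Lemma shift_indep t D B : Tp t -> F 0 t D -> @measurable _ Om0 B ->
  P (D `&` theta t @^-1` B) = (P D * P B)%E.
Proof.
move=> Tt FD mB; have [TTt t0] := Tt.
have -> : P B = P (theta t @^-1` B).
  case: rds => _ [_ [_ [_ [_ [_ [_ [h _]]]]]]].
  by rewrite h//; exact: future_measurable.
case: (rds) => _ [_ [_ [_ [_ [_ [Fth [_ [h _]]]]]]]].
apply: (h t TTt); first by apply: sub_sigma_algebra; exists t; rewrite subrr.
move: B mB; apply: smallest_sub.
  split; first by rewrite /= preimage_set0; exact: sigma_algebra0.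
    by move=> A /= mA; rewrite setTD preimage_setC; exact: sigma_algebraC.
  by move=> A mA /=; rewrite preimage_bigcup; exact: sigma_algebra_bigcup.
move=> B [s [Ts FB]]; apply: sub_sigma_algebra; exists s; split=> //.
have Tts : Tset tt (t + s) by have [] := Tplus_add Tt Ts.
have := Fth t t (t + s) TTt TTt Tts; rewrite lerDl => /(_ Ts.2 B).
rewrite subrr addrAC subrr add0r => -[/(_ FB) [A [FA ->]] _].
(* The filtration is transported by images; since [theta t] is injective, the preimage of the image
   is [A] itself. *)
suff -> : theta t @^-1` (theta t @` A) = A by [].
apply/seteqP; split=> [w /= [w' Aw' e]|w Aw]; last by exists w.
have th w1 : theta (- t) (theta t w1) = w1 by exact: (congr1 (@^~ w1) (theta_inv TTt)).
by rewrite -(th w) -e th.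
Qed.

Lemma theta_future_measurable t : Tp t ->
  measurable_fun [set: Omega] (theta t : Omega -> Om0).
Proof.
move=> Tt _ A mA; apply: theta_measurable => //.
exact: future_measurable.
Qed.

(* The present is frozen: given the past up to time [t], the shifted noise is a
   fresh independent copy. *)
Lemma freeze t (Tt : Tp t) (E : set (Omt t * Om0)) : measurable E ->
  ((Pt Tt \x P0) E = P [set w | E (w, theta t w)])%E.
Proof.
move=> mE.
have mj : measurable_fun [set: Omega] (fun w => (w, theta t w) : Omt t * Om0).
  apply: measurable_fun_pair; last exact: theta_future_measurable.
  exact: sub_id_measurable (F_sub Tt).
pose j : {mfun Omega >-> (Omt t * Om0)%type} := mfun_Sub (mem_set mj).
rewrite (@product_measure_unique _ _ _ _ R (Pt Tt) P0 (distribution P j))//.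
move=> A B mA mB; apply: (@shift_indep t A B) => //.
by rewrite -F_measurableE.
Qed.

(** The Markov property as a lower bound: on a past event [D] where the state [Y] leaves a chance at
    least [e] for [E], the fresh noise realises [E] on at least a fraction [e] of [D]. *)
Lemma markov_ge dT (T : measurableType dT) (t e : R) (Y : Omega -> T)
    (E : set (T * Om0)) (D : set Omega) : Tp t -> 0 <= e ->
  measurable_fun setT (Y : Omt t -> T) -> measurable E -> F 0 t D ->
  (forall w, D w -> (e%:E <= P (xsection E (Y w)))%E) ->
  (e%:E * P D <= P (D `&` [set w | E (Y w, theta t w)]))%E.
Proof.
move=> Tt e0 mY mE FD De.
have mD : @measurable _ (Omt t) D by rewrite F_measurableE.
pose E' : set (Omt t * Om0) := (D `*` setT) `&` (fun z => (Y z.1, z.2)) @^-1` E.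
have mE' : measurable E'.
  apply: measurableI; first exact: measurableX.
  rewrite -[X in measurable X]setTI; apply: measurable_fun_pair => //.
    exact: (measurableT_comp mY measurable_fst).
have -> : D `&` [set w | E (Y w, theta t w)] = [set w | E' (w, theta t w)].
  by apply/seteqP; split=> w; rewrite /E' /=; tauto.
rewrite -(freeze Tt mE') /product_measure1.
have mf := measurable_fun_xsection P0 mE'.
apply: (@le_trans _ _ (\int[Pt Tt]_(w in D) (P0 \o xsection E') w)%E); last first.
  by apply: ge0_subset_integral => //.
rewrite -[leLHS]/(e%:E * Pt Tt D)%E -integral_cst//.
apply: ge0_le_integral => //.
  move=> _ B mB; apply: measurableI => //; rewrite -[X in measurable X]setTI; exact: mf.
move=> w Dw /=; apply: le_trans (De w Dw) _.
rewrite le_eqVlt; apply/orP; left; apply/eqP; congr (P _).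
by apply/seteqP; split=> z; rewrite /xsection /= !inE /E' /=; tauto.
Qed.

End random_dynamical_system.

(** * Levy's upward theorem along the noise *)

Lemma ge0_cvge0P {R : realType} (v : nat -> \bar R) : (forall n, 0 <= v n)%E ->
  (v @ \oo --> 0%E) <->
  (forall e : R, 0 < e -> exists N, forall n, (N <= n)%N -> (v n < e%:E)%E).
Proof.
move=> v0; split=> [/fine_cvgP[[M _ hM] /cvgrPdist_lt cv] e e0|h].
  have [N _ hN] := cv e e0; exists (maxn M N) => n; rewrite geq_max => /andP[Mn Nn].
  have := hN n Nn; rewrite /= sub0r normrN ger0_norm ?fine_ge0// -lte_fin fineK//.
  exact: hM.
have fv : exists M, forall n, (M <= n)%N -> v n \is a fin_num.
  have [M hM] := h 1 ltr01; exists M => n /hM v1.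
  by rewrite ge0_fin_numE// (lt_trans v1)// ltry.
have [M hM] := fv; apply/fine_cvgP; split; first by exists M.
apply/cvgrPdist_lt => e e0; have [N hN] := h e e0.
exists (maxn M N) => // n /=; rewrite geq_max => /andP[Mn Nn].
by rewrite sub0r normrN ger0_norm ?fine_ge0// -lte_fin fineK ?hM//; exact: hN.
Qed.

Lemma measurable_superlevel {R : realType} {dT} {T : measurableType dT}
    (f : T -> \bar R) (y : \bar R) :
  measurable_fun setT f -> measurable [set x | (y <= f x)%E].
Proof.
move=> mf; rewrite -[X in measurable X]setTI -preimage_itvcy.
by apply: mf => //; exact: emeasurable_itv.
Qed.

Section convergence.
Context {R : realType} {tt : timeset} {dO : measure_display}
  {Omega : measurableType dO} {F : R -> R -> set (set Omega)}
  {theta : R -> Omega -> Omega} {P : probability Omega R}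
  {X : pointedType} {d : X -> X -> R} {phi : R -> Omega -> X -> X}.
Hypothesis rds : RDS_memoryless tt F theta P d phi.
Local Notation Tp := (@Tplus R tt).
Local Notation Om0 := (g_sigma_algebraType (@future R tt dO Omega F)).
Local Notation Omt t := (g_sigma_algebraType (F 0 t)).

Let approximable (C : set Omega) := forall r : R, 0 < r -> exists n C',
  [/\ F 0 n%:R C', (P (C `\` C') < r%:E)%E & (P (C' `\` C) < r%:E)%E].

Lemma F_set0 t : Tp t -> F 0 t set0.
Proof.
by move=> Tt; rewrite -(F_measurableE rds)//; exact: (@measurable0 _ (Omt t)).
Qed.

Lemma F_setU t A B : Tp t -> F 0 t A -> F 0 t B -> F 0 t (A `|` B).
Proof.
by move=> Tt; rewrite -(F_measurableE rds)//; exact: (@measurableU _ (Omt t)).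
Qed.

Lemma F_setC t A : Tp t -> F 0 t A -> F 0 t (~` A).
Proof.
by move=> Tt; rewrite -(F_measurableE rds)//; exact: (@measurableC _ (Omt t)).
Qed.

Lemma F_setD t A B : Tp t -> F 0 t A -> F 0 t B -> F 0 t (A `\` B).
Proof.
by move=> Tt; rewrite -(F_measurableE rds)//; exact: (@measurableD _ (Omt t)).
Qed.

Let approximableU A B : measurable A -> measurable B ->
  approximable A -> approximable B -> approximable (A `|` B).
Proof.
move=> mA mB aA aB r r0; have r2 : 0 < r / 2 by rewrite divr_gt0.
have [m [A' [FA' A1 A2]]] := aA _ r2; have [n [B' [FB' B1 B2]]] := aB _ r2.
have mA' := F_sub rds (Tplus_nat _ _) FA'; have mB' := F_sub rds (Tplus_nat _ _) FB'.
have sub4 (S1 S2 S3 S4 : set Omega) : measurable S1 -> measurable S2 ->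
    measurable S3 -> measurable S4 ->
    (P (S1 `\` S2) < (r / 2)%:E)%E -> (P (S3 `\` S4) < (r / 2)%:E)%E ->
    (P ((S1 `|` S3) `\` (S2 `|` S4)) < r%:E)%E.
  move=> m1 m2 m3 m4 h1 h2.
  apply: (@le_lt_trans _ _ (P ((S1 `\` S2) `|` (S3 `\` S4)))).
    apply: le_measure; rewrite ?inE.
    - by apply: measurableD; exact: measurableU.
    - by apply: measurableU; exact: measurableD.
    - by move=> w [[?|?] /not_orP[]]; [left|right].
  apply: le_lt_trans (measureU2 _ _ _) _; try exact: measurableD.
  by rewrite [r]splitr EFinD; exact: lteD.
exists (maxn m n), (A' `|` B'); split.
- apply: F_setU; first exact: Tplus_nat.
    apply: (F_mono rds) FA'; try exact: Tplus_nat.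
    by rewrite ler_nat leq_maxl.
  apply: (F_mono rds) FB'; try exact: Tplus_nat.
  by rewrite ler_nat leq_maxr.
- exact: sub4.
- exact: sub4.
Qed.

(** Approximable sets form a sigma-algebra: a countable union is first cut to finitely many terms,
    whose integer horizons have a maximum. *)
Lemma future_approx (C : set Omega) : @measurable _ Om0 C -> forall r : R, 0 < r ->
  exists n C',
    [/\ F 0 n%:R C', (P (C `\` C') < r%:E)%E & (P (C' `\` C) < r%:E)%E].
Proof.
suff h : @measurable _ Om0 `<=` [set C | measurable C /\ approximable C].
  by move=> /h[].
apply: smallest_sub.
  split.
  - split=> // r r0; exists 0%N, set0; rewrite setD0 measure0 lte_fin; split=> //.
    by apply: F_set0; exact: Tplus_nat.
  - move=> A [mA aA]; split; first by rewrite setTD; exact: measurableC.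
    move=> r r0; have [n [C' [FC' h1 h2]]] := aA r r0; exists n, (~` C').
    rewrite setTD; split; first by apply: F_setC => //; exact: Tplus_nat.
      by rewrite setDE setCK setIC -setDE.
    by rewrite setDE setCK setIC -setDE.
  - move=> A hA; have mA n : measurable (A n) by have [] := hA n.
    split; first exact: bigcupT_measurable.
    move=> r r0; have r2 : 0 < r / 2 by rewrite divr_gt0.
    pose B N := \bigcup_(i < N) A i.
    have mB N : measurable (B N) by apply: bigcup_measurable => i _; exact: mA.
    have aB N : approximable (B N).
      suff : measurable (B N) /\ approximable (B N) by case.
      rewrite /B bigcup_mkord.
      apply: (big_ind (fun S => measurable S /\ approximable S)) => //.
      + split=> // s s0; exists 0%N, set0; rewrite setD0 measure0 lte_fin; split=> //.
        by apply: F_set0; exact: Tplus_nat.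
      + move=> S1 S2 [? ?] [? ?]; split; first exact: measurableU.
        exact: approximableU.
      + by move=> i _; exact: hA.
    have mU : measurable (\bigcup_i A i) by exact: bigcupT_measurable.
    have cB : (P \o B @ \oo --> P (\bigcup_i A i)).
      have -> : \bigcup_i A i = \bigcup_k B k.
        apply/seteqP; split=> [w [i _ Aw]|w [k _ [i _ Aw]]]; last by exists i.
        by exists i.+1 => //; exists i => /=.
      apply: nondecreasing_cvg_mu => //; first exact: bigcupT_measurable.
      move=> m n mn; apply/subsetPset => w [i /= im Aw]; exists i => //=.
      exact: leq_trans mn.
    have [M hM] : exists M, (P ((\bigcup_i A i) `\` B M) < (r / 2)%:E)%E.
      apply: contrapT => /forallNP nN.
      have : (P (\bigcup_i A i) <= P (\bigcup_i A i) - (r / 2)%:E)%E.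
        rewrite -{1}(cvg_lim _ cB)//; apply: lime_le.
          by apply/cvg_ex; eexists; exact: cB.
        apply: nearW => n; rewrite [leLHS]/(P (B n)) leeBrDr//.
        have /negP := nN n; rewrite -leNgt => /(leeD2l (P (B n))).
        rewrite -measureU//; last 2 first.
        + by apply: measurableD.
        + by rewrite setDE setICA setICr setI0.
        rewrite setDUK// => w [i _ Aw]; by exists i.
      rewrite leNgt => /negP; apply.
      by rewrite lteBlDr ?fin_num_measure// lteDl ?fin_num_measure// lte_fin.
    have [n [C' [FC' h1 h2]]] := aB M _ r2.
    have mC' := F_sub rds (Tplus_nat _ _) FC'.
    exists n, C'; split=> //.
      apply: (@le_lt_trans _ _ (P (((\bigcup_i A i) `\` B M) `|` (B M `\` C')))).
        apply: le_measure; rewrite ?inE.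
        - exact: measurableD.
        - by apply: measurableU; exact: measurableD.
        - by move=> w [Uw nC]; case: (pselect (B M w)) => ?; [right|left].
      apply: le_lt_trans (measureU2 _ _ _) _; try exact: measurableD.
      by rewrite [r]splitr EFinD; exact: lteD.
    apply: (@le_lt_trans _ _ (P (C' `\` B M))).
      apply: le_measure; rewrite ?inE; try exact: measurableD.
      by apply: setDS => w [i _ Aw]; exists i.
    by apply: lt_trans h2 _; rewrite lte_fin; lra.
move=> A [s [Ts FA]]; split; first exact: F_sub rds _ Ts _ FA.
move=> r r0; exists (Num.bound s), A; rewrite setDv measure0 lte_fin; split=> //.
apply: (F_mono rds) FA => //; first exact: Tplus_nat.
by apply/ltW/archi_boundP; case: Ts.
Qed.

(** Approximate [C] by [C'], known at time [N]. For [n >= N] the part [D] of the level event outside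
    [C'] is known at time [n], so by [markov_ge] at least a fraction [e] of it lies in [C] outside
    [C'], which is small. What remains off [C] lies in [C'] outside [C]. *)
Lemma levy_upward dT (T : measurableType dT) (E : set (T * Om0)) (C : set Omega)
    (Y : nat -> Omega -> T) (e : R) :
  0 < e -> measurable E -> @measurable _ Om0 C ->
  (forall n, measurable_fun setT (Y n : Omt n%:R -> T)) ->
  (forall n w, E (Y n w, theta n%:R w) -> C w) ->
  P (~` C `&` [set w | (e%:E <= P (xsection E (Y n w)))%E]) @[n --> \oo] --> 0%E.
Proof.
move=> e0 mE mC mY EC.
pose K := [set z | (e%:E <= P0 rds (xsection E z))%E].
have mK : measurable K.
  by apply: measurable_superlevel; exact: measurable_fun_xsection.
have FK n : F 0 n%:R [set w | K (Y n w)].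
  rewrite -(F_measurableE rds); last exact: Tplus_nat.
  by rewrite -[X in measurable X]setTI; exact: mY.
have mYK n : measurable [set w | K (Y n w)].
  exact: (F_sub rds (Tplus_nat _ _) (FK n)).
have mC' : measurable C by exact: (future_measurable rds mC).
apply/ge0_cvge0P => [n|r r0]; first exact: measure_ge0.
(* The factor [e] pays for the division by [e] in the Markov bound on [D]; the plain [r / 2] bounds
   [C'] outside [C]. *)
pose s := Num.min (r / 2) (r / 2 * e).
have s0 : 0 < s by rewrite lt_min !mulr_gt0// divr_gt0.
have [N [C' [FC' C1 C2]]] := future_approx mC s0.
have mCC := F_sub rds (Tplus_nat _ _) FC'.
exists N => n Nn.
pose D := [set w | K (Y n w)] `\` C'.
have FD : F 0 n%:R D.
  apply: F_setD => //; first exact: Tplus_nat.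
  by apply: (F_mono rds) FC'; rewrite ?ler_nat//; exact: Tplus_nat.
have mD := F_sub rds (Tplus_nat _ _) FD.
have h1 : (e%:E * P D <= P (C `\` C'))%E.
  apply: le_trans (markov_ge rds (Tplus_nat _ n) (ltW e0) (mY n) mE FD _) _.
    by move=> w [].
  apply: le_measure; rewrite ?inE.
  - apply: measurableI => //; rewrite -[X in measurable X]setTI.
    have mj : measurable_fun setT (fun w => (Y n w, theta n%:R w) : T * Om0).
      apply: measurable_fun_pair; last first.
        by apply: (theta_future_measurable rds); exact: Tplus_nat.
      move=> _ B mB; have := mY n measurableT B mB.
      rewrite (F_measurableE rds); last exact: Tplus_nat.
      by apply: (F_sub rds); exact: Tplus_nat.
    exact: mj.
  - exact: measurableD.
  - by move=> w [[_ nC'] /EC].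
have PD : (P D < (r / 2)%:E)%E.
  have : (e%:E * P D < (r / 2 * e)%:E)%E.
    apply: le_lt_trans h1 (lt_le_trans C1 _).
    by rewrite lee_fin ge_min lexx orbT.
  by rewrite mulrC EFinM lte_pmul2l// lte_fin.
apply: (@le_lt_trans _ _ (P (D `|` (C' `\` C)))).
  apply: le_measure; rewrite ?inE.
  - by apply: measurableI; [exact: measurableC|exact: (mYK n)].
  - by apply: measurableU => //; exact: measurableD.
  - by move=> w [nC Kw]; case: (pselect (C' w)) => ?; [right|left].
apply: le_lt_trans (measureU2 _ _ _) _ => //; first exact: measurableD.
rewrite [r]splitr EFinD; apply: lteD => //.
by apply: lt_le_trans C2 _; rewrite lee_fin ge_min lexx.
Qed.

End convergence.

(** * From recurrence to probability one *)

Section product_null.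
Context {R : realType} {d1 d2} {T1 : measurableType d1} {T2 : measurableType d2}.
Local Open Scope ereal_scope.

Lemma product_null_aeP (m1 : {measure set T1 -> \bar R})
    (m2 : {sigma_finite_measure set T2 -> \bar R}) (B : set (T1 * T2)) :
  measurable B ->
  (m1 \x m2) B = 0 <-> {ae m1, forall x, m2 (xsection B x) = 0}.
Proof.
move=> mB; have mf := measurable_fun_xsection m2 mB.
have := ae_eq_integral_abs m1 measurableT mf.
rewrite /product_measure1 (eq_integral (m2 \o xsection B)); last first.
  by move=> x _ /=; rewrite gee0_abs.
move=> ->; split; apply: filterS => x /= h; first exact: h.
by move=> _; exact: h.
Qed.

Lemma product_null_ysectionP (m1 : {sigma_finite_measure set T1 -> \bar R})
    (m2 : {sigma_finite_measure set T2 -> \bar R}) (B : set (T1 * T2)) :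
  measurable B ->
  (m1 \x m2) B = 0 <-> {ae m2, forall y, m1 (ysection B y) = 0}.
Proof.
move=> mB; have mf := measurable_fun_ysection m1 mB.
have -> : (m1 \x m2) B = (m1 \x^ m2) B.
  by apply: product_measure_unique => // C D mC mD /=; rewrite product_measure2E.
have := ae_eq_integral_abs m2 measurableT mf.
rewrite /product_measure2 (eq_integral (m1 \o ysection B)); last first.
  by move=> x _ /=; rewrite gee0_abs.
move=> ->; split; apply: filterS => x /= h; first exact: h.
by move=> _; exact: h.
Qed.

End product_null.

Section recurrence_to_full.
Context {R : realType} {tt : timeset} {dO : measure_display}
  {Omega : measurableType dO} {F : R -> R -> set (set Omega)}
  {theta : R -> Omega -> Omega} {P : probability Omega R}
  {X : pointedType} {d : X -> X -> R} {phi : R -> Omega -> X -> X}.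
Hypothesis rds : RDS_memoryless tt F theta P d phi.
Local Notation Om0 := (g_sigma_algebraType (@future R tt dO Omega F)).
Local Notation Omt t := (g_sigma_algebraType (F 0 t)).

(* Levy's upward theorem forces the conditional probability of [E] to vanish
   along the flow off [E], which is incompatible with the flow spending most
   of its time in a set on which that probability is bounded below. *)
Lemma recurrent_full dT (T : measurableType dT) (mu : probability T R)
    (flow : nat -> Omega -> T -> T) (E : set (T * Om0)) :
  measurable E ->
  (forall n, measurable_fun setT (fun z : T * Om0 => flow n z.2 z.1)) ->
  (forall n z, measurable_fun setT ((fun w => flow n w z) : Omt n%:R -> T)) ->
  (forall n z w, E (flow n w z, theta n%:R w) -> E (z, w)) ->
  (forall r : R, 0 < r -> exists e K,
    [/\ 0 < e, measurable K, forall z, K z -> (e%:E <= P (xsection E z))%E &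
      forall n, ((mu \x P0 rds) [set z | ~ K (flow n z.2 z.1)] <= r%:E)%E]) ->
  ((mu \x P0 rds) (~` E) = 0)%E.
Proof.
move=> mE mflow mflowz EE hK.
pose M : probability (T * Om0)%type R := (mu \x P0 rds)%E.
change (M (~` E) = 0%E); apply/eqP; rewrite -measure_le0.
apply/lee_addgt0Pr => r r0; rewrite add0e.
have r2 : 0 < r / 2 by rewrite divr_gt0.
have [e [K [e0 mK hE hn]]] := hK _ r2.
pose A n := [set z : T * Om0 | K (flow n z.2 z.1)].
have mA n : measurable (A n) by rewrite -[X in measurable X]setTI; exact: mflow.
pose f n (z : T) := P0 rds (xsection (~` E `&` A n) z).
have mEA n : measurable (~` E `&` A n).
  by apply: measurableI => //; exact: measurableC.
have mf n : measurable_fun setT (f n) by exact: measurable_fun_xsection.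
(* For a fixed start [z] the event to predict is the section of [E], and [EE] says that its
   occurrence after time [n] implies its occurrence from the start. *)
have f0 z : f ^~ z @ \oo --> 0%E.
  have mEz : measurable (xsection E z) by exact: measurable_xsection.
  have EC n w : E (flow n w z, theta n%:R w) -> xsection E z w.
    by move=> /EE h; rewrite /xsection /= inE.
  have lev := levy_upward rds e0 mE mEz (mflowz ^~ z) EC.
  apply/ge0_cvge0P => [n|s s0]; first exact: measure_ge0.
  have [N hN] := (ge0_cvge0P (fun n => measure_ge0 P _)).1 lev s s0.
  exists N => n /hN; apply: le_lt_trans.
  rewrite -[leLHS]/(P (xsection (~` E `&` A n) z)).
  apply: le_measure; rewrite ?inE.
  - exact/(future_measurable rds)/measurable_xsection.
  - apply: measurableI; first exact/measurableC/(future_measurable rds).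
    have mg : measurable [set x | (e%:E <= (P0 rds \o xsection E) x)%E].
      by apply: measurable_superlevel; exact: measurable_fun_xsection.
    have := mflowz n z measurableT _ mg; rewrite setTI (F_measurableE rds); last first.
      exact: Tplus_nat.
    by apply: (F_sub rds); exact: Tplus_nat.
  - move=> w; rewrite /xsection /= !inE /= => -[nE Kw]; split=> //.
    exact: hE.
have [|_ _] := @dominated_convergence _ T R mu setT measurableT f (cst 0%E) (cst 1%E)
  mf (measurable_cst _) (aeW _ (fun z _ => f0 z))
  (finite_measure_integrable_cst mu 1 measurableT).
  apply: aeW => z n _; rewrite gee0_abs ?measure_ge0//.
  by apply: probability_le1; exact: measurable_xsection.
rewrite integral0 => /(ge0_cvge0P (fun n => integral_ge0 _ (fun z _ => measure_ge0 _ _))).1.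
move=> /(_ _ r2)[N /(_ N (leqnn N)) hN].
(* The first term is small for this [N] by dominated convergence over the starting point; the second
   is at most [r / 2] at every time by the choice of [K]. *)
apply: (@le_trans _ _ (M (~` E `&` A N) + M (~` A N))%E).
  apply: le_trans (measureU2 _ _ _) => //; last exact: measurableC.
  apply: le_measure; rewrite ?inE; first exact: measurableC.
    by apply: measurableU => //; exact: measurableC.
  by move=> z nE; case: (pselect (A N z)) => ?; [left|right].
rewrite [in leRHS](splitr r) EFinD; apply: leeD; first exact: ltW.
exact: hn.
Qed.

End recurrence_to_full.

(** * Measurability of the flow *)

Definition phi2 {R : realType} {Omega X : Type} (phi : R -> Omega -> X -> X)
    (t : R) (w : Omega) (z : X * X) : X * X := (phi t w z.1, phi t w z.2).

Section state_space.
Context {R : realType} {tt : timeset} {dO : measure_display}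
  {Omega : measurableType dO} {F : R -> R -> set (set Omega)}
  {theta : R -> Omega -> Omega} {P : probability Omega R}
  {X : pointedType} {d : X -> X -> R} {phi : R -> Omega -> X -> X}.
Hypothesis rds : RDS_memoryless tt F theta P d phi.
Local Notation Tp := (@Tplus R tt).
Local Notation rtime := (@rtime R tt).
Local Notation Om0 := (g_sigma_algebraType (@future R tt dO Omega F)).
Local Notation Omt t := (g_sigma_algebraType (F 0 t)).

Lemma rds_metric : is_metric d.
Proof. by case: rds => _ [_ [_ [_ [_ [_ [_ [_ [_ [h _]]]]]]]]]. Qed.

Lemma rds_separable : dseparable d.
Proof. by case: rds => _ [_ [_ [_ [_ [_ [_ [_ [_ [_ [h _]]]]]]]]]]. Qed.

Lemma rds_completion : borel_in_completion d.
Proof. by case: rds => _ [_ [_ [_ [_ [_ [_ [_ [_ [_ [_ [h _]]]]]]]]]]]. Qed.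

Lemma phi_continuous t w : Tp t -> dcontinuous d (phi t w).
Proof. by case: rds => _ [_ [_ [_ [_ [_ [_ [_ [_ [_ [_ [_ [h _]]]]]]]]]]]] /h. Qed.

Lemma phi_past t x B : Tp t -> dborel d B -> F 0 t [set w | B (phi t w x)].
Proof.
by case: rds => _ [_ [_ [_ [_ [_ [_ [_ [_ [_ [_ [_ [_ [h _]]]]]]]]]]]]] /h; exact.
Qed.

Lemma phi0 w : phi 0 w = id.
Proof. by case: rds => _ [_ [_ [_ [_ [_ [_ [_ [_ [_ [_ [_ [_ [_ [h _]]]]]]]]]]]]]]. Qed.

Lemma phi_cocycle s t w x : Tp s -> Tp t ->
  phi (s + t) w x = phi t (theta s w) (phi s w x).
Proof.
move=> Ts Tt; case: rds => _ [_ [_ [_ [_ [_ [_ [_ [_ [_ [_ [_ [_ [_ [_ [h _]]]]]]]]]]]]]]].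
by rewrite h.
Qed.

Lemma phi_right_limit w (q : nat -> R) t x :
  (forall n, rtime (q n)) -> Tp t -> (forall n, q n.+1 <= q n) ->
  (forall e, 0 < e -> exists N, forall n, (N <= n)%N -> `|q n - t| < e) ->
  dconv d (fun n => phi (q n) w x) (phi t w x).
Proof.
move=> rq Tt dq qt.
case: rds => _ [_ [_ [_ [_ [_ [_ [_ [_ [_ [_ [_ [_ [_ [_ [_ h]]]]]]]]]]]]]]].
apply: (h w q t (fun=> x) x) => //; first by move=> n; case: (rq n).
by move=> e e0; exists 0%N => n _; rewrite (is_metric_refl rds_metric).
Qed.

Lemma phi_measurable t x : Tp t ->
  measurable_fun setT ((fun w => phi t w x) : Omt t -> XB d).
Proof.
by move=> Tt _ B mB; rewrite setTI (F_measurableE rds)//; exact: phi_past.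
Qed.

Lemma phi_future t x B : Tp t -> dborel d B -> @measurable _ Om0 [set w | B (phi t w x)].
Proof. by move=> Tt mB; apply: (F_future Tt); exact: phi_past. Qed.

Lemma phi2_measurable t z : Tp t ->
  measurable_fun setT ((fun w => phi2 phi t w z) : Omt t -> (XB d * XB d)%type).
Proof. by move=> Tt; apply: measurable_fun_pair; exact: phi_measurable. Qed.

(** By right continuity an open condition at [t] persists at rational times just after it. The bound
    [t <= q] is recorded because contraction concerns late times. *)
Lemma open_hit_rtime W t w z : Tp t -> dopen2 d W -> W (phi2 phi t w z) ->
  exists q, [/\ rtime q, t <= q & W (phi2 phi q w z)].
Proof.
move=> Tt oW /oW[e [e0 he]]; have [q [rq dq tq qt]] := rtime_approx Tt.
have [m hm] := phi_right_limit w z.1 rq Tt dq qt e0.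
have [n hn] := phi_right_limit w z.2 rq Tt dq qt e0.
exists (q (maxn m n)); split=> //; apply: he; rewrite (is_metric_sym rds_metric).
  by apply: hm; exact: leq_maxl.
by apply: hn; exact: leq_maxr.
Qed.

Section dense.
Variable (u : nat -> X).
Hypothesis hu : forall x e, 0 < e -> exists n, d (u n) x < e.
Local Notation bb := (base_ball d u).

(** Continuity in the state and measurability in the noise: [phi t w x] lies in [U] exactly when the
    dense points of some base ball around [x] are all sent into one [inner_closed d U n], a
    countable condition. *)
Lemma phi_jointly_measurable t : Tp t ->
  measurable_fun setT ((fun z => phi t z.2 z.1) : XB d * Om0 -> XB d).
Proof.
move=> Tt; have md := rds_metric.
apply: (@measurability _ _ _ (XB d) _ _ (dopen d)) => //.
move=> _ [U oU <-]; rewrite setTI.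
have cl n : @measurable _ (XB d) (inner_closed d U n).
  by apply: dborel_closed; exact: inner_closedC.
rewrite (_ : _ @^-1` U = \bigcup_(i in setT) \bigcup_n (bb i `*`
    \bigcap_(k in [set k | bb i (u k)]) [set w | inner_closed d U n (phi t w (u k))])).
  apply: countable_bigcup_measurable => [|i _]; first exact: countableP.
  apply: bigcupT_measurable => n; apply: measurableX.
    by apply: base_ball_measurable.
  apply: countable_bigcap_measurable => [|k _]; first exact: countableP.
  exact: (phi_future (u k) Tt (cl n)).
apply/seteqP; split=> [[x w] /= Ux|[x w] [i _ [n _ [/= xi /= h]]]].
  have [n [e [e0 he]]] := inner_closed_ball md oU Ux.
  have [i [xi ib]] := base_ballP md hu (dcontinuous_preimage_open
    (phi_continuous w Tt) (@dball_open _ _ _ md (phi t w x) e)) (dball_center md _ e0).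
  by exists i => //; exists n => //; split=> //= k /= /ib /he.
(* If [x] were sent outside the closed set, so would be an open part of the base ball, which
   contains a dense point. *)
apply: (inner_closed_sub md (n := n)).
apply: contrapT => nc; have := inner_closedC md (U := U) (n := n).
move=> /(dcontinuous_preimage_open (phi_continuous w Tt)).
move=> /(dopenI (base_ball_open md (u := u) (i := i))) oV.
have [k [[ik nk] _]] := dense_open md hu oV (conj xi nc) ltr01.
exact: nk (h k ik).
Qed.

Lemma phi2_jointly_measurable t : Tp t ->
  measurable_fun setT ((fun z => phi2 phi t z.2 z.1) :
    XB d * XB d * Om0 -> (XB d * XB d)%type).
Proof.
move=> Tt; apply: measurable_fun_pair.
  apply: (measurableT_comp (phi_jointly_measurable Tt)
    (g := fun z : XB d * XB d * Om0 => (z.1.1, z.2))).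
  apply: measurable_fun_pair; last exact: measurable_snd.
  exact: measurableT_comp measurable_fst measurable_fst.
apply: (measurableT_comp (phi_jointly_measurable Tt)
  (g := fun z : XB d * XB d * Om0 => (z.1.2, z.2))).
apply: measurable_fun_pair; last exact: measurable_snd.
exact: measurableT_comp measurable_snd measurable_fst.
Qed.

End dense.
End state_space.

(** * Zero-one law along rational times *)

Lemma ae_forall_countable {R : realType} {dT} {T : measurableType dT}
    (mu : {measure set T -> \bar R}) (I : countType) (Q : I -> T -> Prop) :
  (forall i, {ae mu, forall x, Q i x}) -> {ae mu, forall x, forall i, Q i x}.
Proof.
move=> h.
have : {ae mu, forall x, forall n, forall i : I, unpickle n = Some i -> Q i x}.
  apply: ae_foralln => n; case: (unpickle n) => [i|]; last exact: aeW.
  by apply: filterS (h i) => x Qx j [<-].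
by apply: filterS => x hx i; exact: (hx (pickle i)) (pickleK i).
Qed.

Lemma ae_probability_exists {R : realType} {dT} {T : measurableType dT}
    (mu : probability T R) (A : set T) (Q : T -> Prop) :
  measurable A -> (0 < mu A)%E -> {ae mu, forall x, Q x} -> exists x, A x /\ Q x.
Proof.
move=> mA A0 [N [mN N0 hN]]; apply: contrapT => /forallNP h.
move: A0; rewrite ltNge => /negP; apply; rewrite -N0; apply: le_measure; rewrite ?inE//.
by move=> x Ax; apply: hN => Qx; exact: (h x).
Qed.

Lemma xsection_set {T1 T2 : Type} (Q : T1 -> T2 -> Prop) x :
  xsection [set z | Q z.1 z.2] x = [set y | Q x y].
Proof. by apply/seteqP; split=> y; rewrite /xsection /= inE. Qed.

Section ergodic_measure.
Context {R : realType} {tt : timeset} {dO : measure_display}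
  {Omega : measurableType dO} {F : R -> R -> set (set Omega)}
  {theta : R -> Omega -> Omega} {P : probability Omega R}
  {X : pointedType} {d : X -> X -> R} {phi : R -> Omega -> X -> X}
  {rho : probability (XB d) R}.
Hypothesis rds : RDS_memoryless tt F theta P d phi.
Hypothesis erg : ergodic tt P phi rho.
Variable (u : nat -> X).
Hypothesis hu : forall x e, 0 < e -> exists n, d (u n) x < e.
Local Notation Tp := (@Tplus R tt).
Local Notation rtime := (@rtime R tt).
Local Notation Om0 := (g_sigma_algebraType (@future R tt dO Omega F)).
Local Notation Omt t := (g_sigma_algebraType (F 0 t)).
Local Notation bb := (base_ball d u).

Let M : probability (XB d * Om0)%type R := (rho \x P0 rds)%E.

Lemma phi_preimage_measurable t A : Tp t -> dborel d A ->
  @measurable _ (XB d * Om0)%type [set z | A (phi t z.2 z.1)].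
Proof.
by move=> Tt mA; rewrite -[X in measurable X]setTI; exact: (phi_jointly_measurable rds hu Tt measurableT mA).
Qed.

Lemma stationary_product t A : Tp t -> dborel d A ->
  ((rho \x P0 rds) [set z | A (phi t z.2 z.1)] = rho A)%E.
Proof.
move=> Tt mA; rewrite (erg.1 t A Tt mA) /product_measure1.
by apply: eq_integral => x _ /=; rewrite (xsection_set (fun x w => A (phi t w x))).
Qed.

Let marginal A : dborel d A -> M [set z | A z.1] = rho A.
Proof.
move=> mA; have -> : [set z : XB d * Om0 | A z.1] = A `*` setT.
  by apply/seteqP; split=> [[x w]|[x w] []].
rewrite -[LHS]/((rho \x P0 rds) _)%E product_measure1E//.
by rewrite [X in (_ * X)%E](_ : _ = 1%E) ?mule1//; exact: probability_setT.
Qed.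

Let exit_null Z : dborel d Z ->
  (forall r, rtime r -> forall x, Z x -> P [set w | ~ Z (phi r w x)] = 0%E) ->
  forall t, Tp t -> M [set z | Z z.1 /\ ~ Z (phi t z.2 z.1)] = 0%E.
Proof.
move=> mZ hZ t Tt; have md := rds_metric rds.
have mZ1 : @measurable _ (XB d * Om0)%type [set z | Z z.1].
  by rewrite -[X in measurable X]setTI; exact: measurable_fst.
have mex C s : Tp s -> dborel d C ->
    @measurable _ (XB d * Om0)%type [set z | Z z.1 /\ ~ C (phi s z.2 z.1)].
  move=> Ts mC; apply: measurableI => //; apply: measurableC.
  exact: phi_preimage_measurable.
apply/eqP; rewrite -measure_le0; apply/lee_addgt0Pr => e e0; rewrite add0e.
have [C [V [oC oV CZ ZV rVC]]] :=
  @closed_open_regularity _ _ d rho _ d id md (fun _ _ => erefl) Z mZ _ e0.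
have mC : dborel d C by exact: dborel_closed.
have [q [rq dq _ qt]] := rtime_approx Tt.
pose A n := [set z : XB d * Om0 | Z z.1 /\ ~ C (phi (q n) z.2 z.1)].
have mA n : measurable (A n) by apply: mex => //; exact: rtimeP.
(* Leaving [Z] at a rational time is null by assumption, and lying in [Z] outside [C] has the same
   small measure at every time by stationarity. *)
have MA n : (M (A n) <= e%:E)%E.
  have Tq := rtimeP (rq n).
  have M1 : M [set z | Z z.1 /\ ~ Z (phi (q n) z.2 z.1)] = 0%E.
    apply/product_null_aeP; first exact: mex.
    apply: aeW => x; have [Zx|Zx] := pselect (Z x).
      rewrite (_ : xsection _ x = [set w | ~ Z (phi (q n) w x)]); first exact: hZ.
      by apply/seteqP; split=> w; rewrite /xsection /= inE /=; tauto.
    rewrite (_ : xsection _ x = set0) ?measure0//.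
    by apply/seteqP; split=> w; rewrite /xsection /= ?inE /=; tauto.
  have mZC : dborel d (Z `\` C) by exact: (@measurableD _ (XB d)).
  apply: (@le_trans _ _ (M ([set z | Z z.1 /\ ~ Z (phi (q n) z.2 z.1)] `|`
      [set z | (Z `\` C) (phi (q n) z.2 z.1)]))%E).
    apply: le_measure; rewrite ?inE//.
      apply: measurableU; first exact: mex.
      exact: phi_preimage_measurable.
    move=> z [Zz nC]; case: (pselect (Z (phi (q n) z.2 z.1))) => h; last by left.
    by right.
  apply: le_trans (measureU2 _ _ _) _; first exact: mex.
    exact: phi_preimage_measurable.
  rewrite [X in (X + _)%E]M1 add0e [leLHS]stationary_product//.
  apply: le_trans (ltW rVC); apply: le_measure; rewrite ?inE//.
    by apply: measurableD => //; exact: dborel_open.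
  by move=> x [/ZV].
(* A trajectory outside [Z] at time [t] is in the open complement of [C], and stays there at all
   late [q n]: exits lie in the lower limit of the [A n]. *)
pose B N := \bigcap_(n >= N) A n.
have mB N : measurable (B N) by apply: bigcap_measurable => //; exists N => /=.
apply: (@le_trans _ _ (M (\bigcup_N B N))).
  apply: le_measure; rewrite ?inE; first exact: mex.
    exact: bigcupT_measurable.
  move=> [x w] [/= Zx nZ].
  have /oC[r [r0 hr]] : (~` C) (phi t w x) by move=> /CZ.
  have [N hN] := phi_right_limit rds w x rq Tt dq qt r0.
  exists N => // n /= Nn; split=> //; apply: hr.
  by rewrite /dball /= (is_metric_sym md); exact: hN.
have cv : M \o B @ \oo --> M (\bigcup_N B N).
  apply: nondecreasing_cvg_mu => //; first exact: bigcupT_measurable.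
  by move=> m n mn; apply/subsetPset => z h k /= nk; apply: h => /=; exact: leq_trans nk.
rewrite -(cvg_lim _ cv)//; apply: lime_le; first by apply/cvg_ex; eexists; exact: cv.
apply: nearW => n; apply: le_trans (MA n); apply: le_measure; rewrite ?inE//.
by move=> z /(_ n (leqnn n)).
Qed.

(* Invariance along rational times extends to all times by right continuity of
   the trajectories and inner regularity of [rho] by closed sets. *)
Lemma absorbing_zero_one Z : dborel d Z ->
  (forall r, rtime r -> forall x, Z x -> P [set w | ~ Z (phi r w x)] = 0%E) ->
  rho Z = 0%E \/ rho Z = 1%E.
Proof.
move=> mZ hZ; apply: (erg.2) => // t Tt.
pose A := [set z : XB d * Om0 | Z z.1].
pose B := [set z : XB d * Om0 | Z (phi t z.2 z.1)].
have mA : measurable A by rewrite -[X in measurable X]setTI; exact: measurable_fst.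
have mB : measurable B by exact: phi_preimage_measurable.
have AB : M (A `\` B) = 0%E by exact: exit_null.
(* By stationarity [A] and [B] have equal measure, so entries into [Z] balance exits from it. *)
have BA : M (B `\` A) = 0%E.
  have e1 : M A = M B by rewrite [RHS]stationary_product// marginal.
  have e2 : M A = (M (A `\` B) + M (A `&` B))%E := measureDI M mA mB.
  have e3 : M B = (M (B `\` A) + M (B `&` A))%E := measureDI M mB mA.
  rewrite AB add0e e1 in e2; rewrite setIC -e2 in e3.
  have fB : M B \is a fin_num by exact: fin_num_measure.
  by have := congr1 (fun v => v - M B)%E e3; rewrite addeK// subee.
have := (product_null_aeP rho (P0 rds) (measurableD mA mB)).1 AB.
have := (product_null_aeP rho (P0 rds) (measurableD mB mA)).1 BA.
apply: filterS2 => x hB hA.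
have mw : measurable [set w | Z (phi t w x)].
  by apply: (F_sub rds Tt); exact: (phi_past rds x Tt mZ).
have eA : xsection (A `\` B) x = [set w | Z x /\ ~ Z (phi t w x)].
  by apply/seteqP; split=> w; rewrite /xsection /= inE.
have eB : xsection (B `\` A) x = [set w | Z (phi t w x) /\ ~ Z x].
  by apply/seteqP; split=> w; rewrite /xsection /= inE.
rewrite /transP indicE; case: (boolP (x \in Z)) => /= [/set_mem Zx|/negP Zx].
  rewrite -[X in P X]setCK probability_setC; last exact: measurableC.
  have -> : P (~` [set w | Z (phi t w x)]) = 0%E.
    apply: etrans hA; rewrite eA -[RHS]/(P _); congr (P _).
    by apply/seteqP; split=> w /=; tauto.
  by rewrite sube0.
have {}Zx : ~ Z x by move=> /mem_set.
apply: etrans hB; rewrite eB -[RHS]/(P _); congr (P _).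
by apply/seteqP; split=> w /=; tauto.
Qed.

End ergodic_measure.

(** * Hitting probabilities *)

Definition reaching {R : realType} (tt : timeset) {dO : measure_display}
    {Omega : measurableType dO} (P : probability Omega R) {X : Type}
    (phi : R -> Omega -> X -> X) (A : set X) : set X :=
  [set x | exists2 q, rtime tt q & (0 < P [set w | A (phi q w x)])%E].

Section hitting.
Context {R : realType} {tt : timeset} {dO : measure_display}
  {Omega : measurableType dO} {F : R -> R -> set (set Omega)}
  {theta : R -> Omega -> Omega} {P : probability Omega R}
  {X : pointedType} {d : X -> X -> R} {phi : R -> Omega -> X -> X}
  {rho : probability (XB d) R}.
Hypothesis rds : RDS_memoryless tt F theta P d phi.
Hypothesis erg : ergodic tt P phi rho.
Variable (u : nat -> X).
Hypothesis hu : forall x e, 0 < e -> exists n, d (u n) x < e.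
Local Notation Tp := (@Tplus R tt).
Local Notation rtime := (@rtime R tt).
Local Notation Om0 := (g_sigma_algebraType (@future R tt dO Omega F)).
Local Notation Omt t := (g_sigma_algebraType (F 0 t)).
Local Notation bb := (base_ball d u).

Lemma positive_level_sets dT (T : measurableType dT) (mu : probability T R)
    (g : T -> \bar R) (r : R) : measurable_fun setT g -> 0 < r ->
  mu [set x | (0 < g x)%E] = 1%E ->
  exists e : R, 0 < e /\ (mu (~` [set x | (e%:E <= g x)%E]) <= r%:E)%E.
Proof.
move=> mg r0 g1.
have mV (k : nat) : measurable [set x | (k.+1%:R^-1%:E <= g x)%E].
  exact: measurable_superlevel.
have cv : mu \o (fun k : nat => [set x | (k.+1%:R^-1%:E <= g x)%E]) @ \oo --> 1%E.
  rewrite -g1 (_ : [set x | (0 < g x)%E] =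
      \bigcup_(k in setT) [set x | ((k.+1%:R^-1 : R)%:E <= g x)%E]).
    apply: nondecreasing_cvg_mu => //; first exact: bigcupT_measurable.
    move=> m n mn; apply/subsetPset => x /=; apply: le_trans.
    by rewrite lee_fin lef_pV2 ?posrE// ler_nat.
  apply/seteqP; split=> x /= => [gx|[k _]]; last first.
    by apply: lt_le_trans; rewrite lte_fin invr_gt0.
  have [s [s0 sg]] : exists s : R, 0 < s /\ (s%:E <= g x)%E.
    case: (g x) gx => [s s0|_|//]; first by exists s; rewrite -lte_fin.
    by exists 1; rewrite leey.
  have [k ks] := inv_succ_lt s0; exists k => //=; apply: le_trans sg.
  by rewrite lee_fin ltW.
have [k hk] : exists k : nat, (1 - r%:E < mu [set x | (k.+1%:R^-1%:E <= g x)%E])%E.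
  apply: contrapT => /forallNP h.
  have : (1 <= 1 - r%:E :> \bar R)%E.
    rewrite -{1}(cvg_lim _ cv)//; apply: lime_le.
      by apply/cvg_ex; eexists; exact: cv.
    by apply: nearW => n; rewrite leNgt; apply/negP; exact: (h n).
  by rewrite -EFinB lee_fin; lra.
exists k.+1%:R^-1; rewrite invr_gt0; split=> //.
rewrite probability_setC// leeBlDr ?fin_num_measure//.
by rewrite addeC -leeBlDr// ltW.
Qed.

Lemma hit_measurable q A (e : \bar R) : Tp q -> dborel d A ->
  @measurable _ (XB d) [set x | (e <= P [set w | A (phi q w x)])%E].
Proof.
move=> Tq mA; have mB := phi_preimage_measurable rds hu Tq mA.
have hE x : P [set w | A (phi q w x)] = P0 rds (xsection
    ([set z | A (phi q z.2 z.1)] : set (XB d * Om0)) x).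
  by rewrite -[RHS]/(P _); congr (P _); by rewrite (xsection_set (fun x w => A (phi q w x))).
under eq_set do rewrite hE.
by apply: measurable_superlevel; exact: measurable_fun_xsection.
Qed.

Lemma hit_positive_measurable q A : Tp q -> dborel d A ->
  @measurable _ (XB d) [set x | (0 < P [set w | A (phi q w x)])%E].
Proof.
move=> Tq mA; rewrite (_ : [set x | _] =
  ~` [set x | (1 <= P [set w | (~` A) (phi q w x)])%E]).
  apply: measurableC; apply: hit_measurable => //.
  exact: (@measurableC _ (XB d)).
apply/seteqP; split=> x /=;
  rewrite (_ : [set w | (~` A) _] = ~` [set w | A (phi q w x)])//;
  (rewrite probability_setC; last exact: (F_sub rds Tq (phi_past rds x Tq mA)));
  have fP : P [set w | A (phi q w x)] \is a fin_num by
    apply: fin_num_measure; exact: (F_sub rds Tq (phi_past rds x Tq mA)).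
- by rewrite leeBrDr// => h1 h2; move: h1; rewrite ltNge -(@leeD2lE _ 1%E)// adde0 h2.
- move=> h; rewrite ltNge; apply/negP => h'; apply: h.
  by rewrite leeBrDr// -[leRHS]adde0 leeD2l.
Qed.

Lemma reaching_measurable A : dborel d A -> dborel d (reaching tt P phi A).
Proof.
move=> mA; rewrite (_ : reaching tt P phi A =
  \bigcup_(q in rtime) [set x | (0 < P [set w | A (phi q w x)])%E]).
  apply: (@countable_bigcup_measurable _ (XB d)); first exact: rtime_countable.
  by move=> q /rtimeP Tq; exact: hit_positive_measurable.
by apply/seteqP; split=> x [q]; exists q.
Qed.

(** The complement of [reaching A] is absorbing: a chance of arriving in [reaching A] is, by the
    Markov property, a chance of arriving in [A] later. The zero-one law then applies, and
    [reaching A] is not null because it contains [A] through time zero. *)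
Lemma reaching_full A : dborel d A -> (0 < rho A)%E -> rho (reaching tt P phi A) = 1%E.
Proof.
move=> mA A0; have mY := reaching_measurable mA.
have AY : A `<=` reaching tt P phi A.
  move=> x Ax; exists 0; first by have := @rtime_nat R tt 0.
  rewrite (_ : [set w | _] = setT) ?probability_setT//.
  by apply/seteqP; split=> w //= _; rewrite (phi0 rds).
have rY : (0 < rho (reaching tt P phi A))%E.
  by apply: lt_le_trans A0 _; apply: le_measure; rewrite ?inE.
have [||Z0|Z1] := absorbing_zero_one rds erg hu (Z := ~` reaching tt P phi A).
- exact: (@measurableC _ (XB d)).
- move=> r rr x nx; rewrite (_ : [set w | _] = [set w | reaching tt P phi A (phi r w x)]); last first.
    by apply/seteqP; split=> w /=; [move/contrapT|move=> ? ?].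
  have Tr := rtimeP rr.
  apply/eqP; rewrite -measure_le0 leNgt; apply/negP => h.
  have mYr : measurable [set w | reaching tt P phi A (phi r w x)].
    exact: (F_sub rds Tr (phi_past rds x Tr mY)).
  have [||q rq hq] := countable_bigcup_measure_gt0 (rtime_countable tt) _ mYr _ h
    (A := fun q => [set w | (0 < P [set w' | A (phi q w' (phi r w x))])%E]).
  + move=> q /rtimeP Tq; apply: (F_sub rds Tr).
    exact: (phi_past rds x Tr (hit_positive_measurable Tq mA)).
  + by move=> w [q rq ?]; exists q.
  have Tq := rtimeP rq; have mB := phi_preimage_measurable rds hu Tq mA.
  (* The Markov bound needs a uniform level, so [1/(k+1)] is fixed in addition to the time [q]. *)
  have [|||k _ hk] := countable_bigcup_measure_gt0 (countableP setT) _ _ _ hq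
    (A := fun k : nat => [set w | (k.+1%:R^-1%:E <= P [set w' | A (phi q w' (phi r w x))])%E]).
  + move=> k _; apply: (F_sub rds Tr).
    exact: (phi_past rds x Tr (hit_measurable k.+1%:R^-1%:E Tq mA)).
  + apply: (F_sub rds Tr).
    exact: (phi_past rds x Tr (hit_positive_measurable Tq mA)).
  + move=> w /= gw.
    have [s [s0 sg]] : exists s : R, 0 < s /\
        (s%:E <= P [set w' | A (phi q w' (phi r w x))])%E.
      case: (P _) gw => [s s0|_|//]; first by exists s; rewrite -lte_fin.
      by exists 1; rewrite leey.
    have [k ks] := inv_succ_lt s0; exists k => //=; apply: le_trans sg.
    by rewrite lee_fin ltW.
  apply: nx; exists (r + q); first exact: rtime_add.
  have := markov_ge rds (T := XB d) (t := r) (e := k.+1%:R^-1) (Y := fun w => phi r w x)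
    (E := [set z : XB d * Om0 | A (phi q z.2 z.1)])
    (D := [set w | (k.+1%:R^-1%:E <= P [set w' | A (phi q w' (phi r w x))])%E])
    Tr _ (phi_measurable rds x Tr) mB.
  move=> /(_ ltac:(by rewrite invr_ge0)) h1.
  have := h1 (phi_past rds x Tr (hit_measurable k.+1%:R^-1%:E Tq mA)).
  move=> {h1}/(_ _)h1; apply: lt_le_trans (le_trans (h1 _) _).
  + by rewrite mule_gt0// lte_fin invr_gt0.
  + by move=> w /=; rewrite (xsection_set (fun x w => A (phi q w x))).
  + apply: le_measure; rewrite ?inE.
    * apply: measurableI.
        apply: (F_sub rds Tr).
        exact: (phi_past rds x Tr (hit_measurable k.+1%:R^-1%:E Tq mA)).
      rewrite (_ : [set w | _] = [set w | A (phi (r + q) w x)]).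
        apply: (F_sub rds (Tplus_add Tr Tq)).
        exact: (phi_past rds x (Tplus_add Tr Tq) mA).
      by apply/seteqP; split=> w /=; rewrite (phi_cocycle rds).
    * apply: (F_sub rds (Tplus_add Tr Tq)).
      exact: (phi_past rds x (Tplus_add Tr Tq) mA).
    * by move=> w [_] /=; rewrite (phi_cocycle rds).
- by rewrite -[reaching tt P phi A]setCK probability_setC ?Z0 ?sube0//; exact: (@measurableC _ (XB d)).
- move: rY; rewrite -[reaching tt P phi A]setCK probability_setC; last exact: (@measurableC _ (XB d)).
  by rewrite Z1 subee// ltxx.
Qed.

End hitting.

(** * Support and recurrence *)

Lemma ae_imply {R : realType} {dT} {T : measurableType dT}
    (mu : {measure set T -> \bar R}) (A B : T -> Prop) :
  (forall x, A x -> B x) -> {ae mu, forall x, A x} -> {ae mu, forall x, B x}.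
Proof. exact: filterS. Qed.

Lemma ae_imply2 {R : realType} {dT} {T : measurableType dT}
    (mu : {measure set T -> \bar R}) (A B C : T -> Prop) :
  (forall x, A x -> B x -> C x) ->
  {ae mu, forall x, A x} -> {ae mu, forall x, B x} -> {ae mu, forall x, C x}.
Proof. exact: filterS2. Qed.

Lemma ae_full {R : realType} {dT} {T : measurableType dT} (mu : probability T R)
    (A : set T) : measurable A -> mu A = 1%E -> {ae mu, forall x, A x}.
Proof.
move=> mA A1; exists (~` A); split=> //; first exact: measurableC.
by rewrite probability_setC// A1 subee.
Qed.

Section support.
Context {R : realType} {tt : timeset} {dO : measure_display}
  {Omega : measurableType dO} {F : R -> R -> set (set Omega)}
  {theta : R -> Omega -> Omega} {P : probability Omega R}
  {X : pointedType} {d : X -> X -> R} {phi : R -> Omega -> X -> X}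
  {rho : probability (XB d) R}.
Hypothesis rds : RDS_memoryless tt F theta P d phi.
Hypothesis erg : ergodic tt P phi rho.
Variable (u : nat -> X).
Hypothesis hu : forall x e, 0 < e -> exists n, d (u n) x < e.
Local Notation Tp := (@Tplus R tt).
Local Notation rtime := (@rtime R tt).
Local Notation Om0 := (g_sigma_algebraType (@future R tt dO Omega F)).
Local Notation Omt t := (g_sigma_algebraType (F 0 t)).
Local Notation bb := (base_ball d u).

Lemma suppE : supp d rho = \bigcap_(i in [set i | rho (bb i) = 0%E]) ~` bb i.
Proof.
have md := rds_metric rds; apply/seteqP; split=> x.
  move=> sx i /= r0 ix; have [e [e0 he]] := base_ball_open md ix.
  have := sx e e0; rewrite ltNge => /negP; apply; rewrite -r0.
  apply: le_measure; rewrite ?inE//; last exact: base_ball_measurable.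
  by apply: dborel_open; exact: dball_open.
move=> hx e e0.
have [i [ix ib]] := base_ballP md hu (dball_open md (e := e)) (dball_center md x e0).
have mi := base_ball_measurable u md i.
apply: (@lt_le_trans _ _ (rho (bb i))); last first.
  apply: le_measure; rewrite ?inE//.
  by apply: dborel_open; exact: dball_open.
by rewrite lt0e measure_ge0 andbT; apply/eqP => /(hx i); exact.
Qed.

Lemma supp_measurable : dborel d (supp d rho).
Proof.
rewrite suppE; apply: (@countable_bigcap_measurable _ (XB d)).
  exact: countableP.
move=> i _; apply: (@measurableC _ (XB d)).
exact: base_ball_measurable u (rds_metric rds) i.
Qed.

Lemma supp_full : rho (supp d rho) = 1%E.
Proof.
have mS := supp_measurable; have mC := @measurableC _ (XB d) _ mS.
rewrite -[supp d rho]setCK probability_setC//.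
suff -> : rho (~` supp d rho) = 0%E by rewrite sube0.
apply/eqP; rewrite -measure_le0 leNgt; apply/negP => h.
have [||i /= r0] := countable_bigcup_measure_gt0 (T := XB d) (A := bb)
  (countableP [set i | rho (bb i) = 0%E]) _ mC _ h.
- by move=> i _; exact: base_ball_measurable u (rds_metric rds) i.
- by rewrite suppE setC_bigcap; apply: subset_bigcup => i _; rewrite setCK.
- by rewrite r0 ltxx.
Qed.

Lemma supp_base_ball U p : dopen d U -> U p -> supp d rho p ->
  exists i, [/\ bb i p, bb i `<=` U & (0 < rho (bb i))%E].
Proof.
have md := rds_metric rds; move=> oU Up sp.
have [i [ip iU]] := base_ballP md hu oU Up; exists i; split=> //.
have [e [e0 he]] := base_ball_open md ip.
apply: lt_le_trans (sp e e0) _; apply: le_measure; rewrite ?inE//.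
  by apply: dborel_open; exact: dball_open.
exact: base_ball_measurable.
Qed.

Lemma open_base_ball U : dopen d U -> (0 < rho U)%E ->
  exists i, bb i `<=` U /\ (0 < rho (bb i))%E.
Proof.
move=> oU rU.
have [p [Up sp]] := ae_probability_exists (T := XB d) (dborel_open oU) rU
  (ae_full (T := XB d) supp_measurable supp_full).
by have [i []] := supp_base_ball oU Up sp; exists i.
Qed.

Lemma Arho_ae : {ae rho, forall x : XB d, Arho tt P d phi rho x}.
Proof.
have md := rds_metric rds.
have h : {ae rho, forall x : XB d, forall i, (0 < rho (bb i))%E -> reaching tt P phi (bb i) x}.
  apply: ae_forall_countable => i; have mi := base_ball_measurable u md i.
  case: (pselect (0 < rho (bb i))%E) => [r0|]; last by move=> ?; exact: aeW.
  by apply: ae_imply (ae_full (T := XB d) (reaching_measurable rds hu mi)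
    (reaching_full rds erg hu mi r0)) => x.
apply: ae_imply2 (ae_full (T := XB d) supp_measurable supp_full) h => x sx hx; split=> // U oU rU.
have [i [iU ri]] := open_base_ball oU rU; have [q rq hq] := hx i ri.
exists [set w | bb i (phi q w x)]; split; last split=> //.
  apply: (F_sub rds (rtimeP rq)).
  exact: (phi_past rds x (rtimeP rq) (base_ball_measurable u md i)).
by move=> w /= /iU; exists q; split=> //; exact: rtimeP.
Qed.

Let M : probability (XB d * Om0)%type R := (rho \x P0 rds)%E.

(** Almost every point reaches [A] with positive probability, and level sets of this probability
    serve as [K] in [recurrent_full], so some visit is almost sure. Restarting at each integer time
    yields arbitrarily late visits. *)
Lemma return_ae A : dborel d A -> (0 < rho A)%E ->
  {ae rho, forall x : XB d, forall n : nat,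
    {ae P, forall w, exists q, [/\ rtime q, n%:R <= q & A (phi q w x)]}}.
Proof.
move=> mA rA.
pose E : set (XB d * Om0) := \bigcup_(q in rtime) [set z | A (phi q z.2 z.1)].
have mE : measurable E.
  apply: countable_bigcup_measurable; first exact: rtime_countable.
  by move=> q /rtimeP Tq; exact: (phi_preimage_measurable rds hu Tq mA).
have xE x : xsection E x = [set w | exists2 q, rtime q & A (phi q w x)].
  by apply/seteqP; split=> w; rewrite /xsection /= inE.
pose g := P0 rds \o xsection E.
have mg : measurable_fun setT g by exact: measurable_fun_xsection.
have reach_g x : reaching tt P phi A x -> (0 < g x)%E.
  move=> [q rq]; move/lt_le_trans; apply; rewrite -[leRHS]/(P _) xE.
  apply: le_measure; rewrite ?inE.
  - exact: (F_sub rds (rtimeP rq) (phi_past rds x (rtimeP rq) mA)).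
  - by rewrite -xE; exact/(future_measurable rds)/measurable_xsection.
  - by move=> w ?; exists q.
have mg0 : measurable [set x | (0 < g x)%E].
  rewrite -[X in measurable X]setTI -preimage_itvoy; apply: mg => //.
  exact: emeasurable_itv.
have g1 : rho [set x | (0 < g x)%E] = 1%E.
  apply/eqP; rewrite eq_le probability_le1//=.
  rewrite -(reaching_full rds erg hu mA rA); apply: le_measure; rewrite ?inE//.
  exact: (reaching_measurable rds hu mA).
have E0 : (rho \x P0 rds)%E (~` E) = 0%E.
  apply: (@recurrent_full _ _ _ _ _ _ _ _ _ _ rds _ (XB d) rho
    (fun n w x => phi n%:R w x)) => //.
  - by move=> n; exact: (phi_jointly_measurable rds hu (Tplus_nat tt n)).
  - by move=> n x; exact: (phi_measurable rds x (Tplus_nat tt n)).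
  - move=> n x w [q rq /= Aq]; exists (n%:R + q); first exact: rtime_add (rtime_nat _ _) rq.
    by rewrite /= (phi_cocycle rds)//; [exact: Tplus_nat|exact: rtimeP].
  - move=> r r0; have [e [e0 he]] := positive_level_sets mg r0 g1.
    have mK : measurable [set x | (e%:E <= g x)%E] by exact: measurable_superlevel.
    exists e, [set x | (e%:E <= g x)%E]; split=> // n.
    rewrite (stationary_product rds erg (A := ~` [set x | (e%:E <= g x)%E]))//.
      exact: Tplus_nat.
    exact: (@measurableC _ (XB d) _ mK).
(* Points from which a visit is almost sure. By stationarity the motion is almost surely in [G] at
   each integer time, so the Markov bound applies there with level one. *)
pose G := [set x | (1 <= g x)%E].
have mG : measurable G by exact: measurable_superlevel.
have G1 : {ae rho, forall x : XB d, G x}.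
  have := (product_null_aeP rho (P0 rds) (measurableC mE)).1 E0.
  apply: ae_imply => x hx; rewrite /G /=.
  have mEx : measurable (xsection E x) by exact: measurable_xsection.
  have : P0 rds (~` xsection E x) = 0%E.
    by rewrite -hx; congr (P0 rds _); apply/seteqP; split=> w; rewrite /xsection /= !inE.
  rewrite probability_setC// => h; rewrite -[leRHS]/(P0 rds (xsection E x)).
  by rewrite -sube_le0 h.
have GC : rho (~` G) = 0%E by apply/negligibleP => //; exact: measurableC.
have hn (n : nat) : {ae rho, forall x : XB d, P [set w | ~ G (phi n%:R w x)] = 0%E}.
  have Tn := @Tplus_nat R tt n.
  have mGn := phi_preimage_measurable rds hu Tn (@measurableC _ (XB d) _ mG).
  have := (product_null_aeP rho (P0 rds) mGn).1.
  rewrite (stationary_product rds erg (A := ~` G))//; last exact: (@measurableC _ (XB d) _ mG).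
  move=> /(_ GC); apply: ae_imply => x.
  by rewrite (xsection_set (fun x w => (~` G) (phi n%:R w x))).
have := ae_forall_countable hn; apply: ae_imply => x hx n.
have Tn := @Tplus_nat R tt n.
have mGn : measurable [set w | G (phi n%:R w x)].
  exact: (F_sub rds Tn (phi_past rds x Tn mG)).
have mB : measurable [set w | E (phi n%:R w x, theta n%:R w)].
  rewrite -[X in measurable X]setTI.
  have mj : measurable_fun setT (fun w => (phi n%:R w x, theta n%:R w) : XB d * Om0).
    apply: measurable_fun_pair; last by apply: (theta_future_measurable rds).
    move=> _ B mB; rewrite setTI; exact: (F_sub rds Tn (phi_past rds x Tn mB)).
  exact: mj.
have P1 : P [set w | G (phi n%:R w x)] = 1%E.
  rewrite -[X in P X]setCK probability_setC; last exact: measurableC.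
  by have := hx n; rewrite -[[set w | _]]/(~` [set w | G (phi n%:R w x)]) => ->; rewrite sube0.
have h1 := markov_ge rds (T := XB d) (e := 1) (Y := fun w => phi n%:R w x)
  Tn ler01 (phi_measurable rds x Tn) mE (phi_past rds x Tn mG) (fun w h => h).
have PB : P [set w | E (phi n%:R w x, theta n%:R w)] = 1%E.
  apply/eqP; rewrite eq_le probability_le1//=.
  have : (1 <= P ([set w | G (phi n%:R w x)] `&` [set w | E (phi n%:R w x, theta n%:R w)]))%E.
    by apply: le_trans h1; rewrite P1 mule1.
  move/le_trans; apply; apply: le_measure; rewrite ?inE//; exact: measurableI.
exists (~` [set w | E (phi n%:R w x, theta n%:R w)]); split.
- exact: measurableC.
- by rewrite probability_setC// PB subee.
- move=> w; apply: contra_not => -[q rq /= Aq]; exists (n%:R + q); split.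
  + exact: rtime_add (rtime_nat _ _) rq.
  + by rewrite lerDl; case: (rtimeP rq).
  + by rewrite (phi_cocycle rds)//; exact: rtimeP.
Qed.

End support.

(** * Contraction events *)

Section contraction.
Context {R : realType} {tt : timeset} {dO : measure_display}
  {Omega : measurableType dO} {F : R -> R -> set (set Omega)}
  {theta : R -> Omega -> Omega} {P : probability Omega R}
  {X : pointedType} {d : X -> X -> R} {phi : R -> Omega -> X -> X}
  {rho : probability (XB d) R}.
Hypothesis rds : RDS_memoryless tt F theta P d phi.
Variable (u : nat -> X).
Hypothesis hu : forall x e, 0 < e -> exists n, d (u n) x < e.
Local Notation Tp := (@Tplus R tt).
Local Notation rtime := (@rtime R tt).
Local Notation Om0 := (g_sigma_algebraType (@future R tt dO Omega F)).
Local Notation Omt t := (g_sigma_algebraType (F 0 t)).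
Local Notation bb := (base_ball d u).

(** The event whose probability is the [h] of the overview. *)
Definition jointly_contracted (z : X * X) (w : Omega) : Prop :=
  exists V, [/\ dopen d V, V z.1, V z.2 & contracts tt d phi V w].

Local Notation contracted := jointly_contracted.

Lemma contractsS A B w : A `<=` B -> contracts tt d phi B w -> contracts tt d phi A w.
Proof.
move=> AB cB e e0; have [t0 h] := cB e e0; exists t0 => t Tt t0t x y /AB Bx /AB By.
exact: h.
Qed.

Lemma Tplus_sub s t : Tp s -> Tp t -> s <= t -> Tp (t - s).
Proof.
move=> [Ts s0] [Tt t0] st; split; last by rewrite subr_ge0.
by move: Ts Tt; case: (tt) => // -[z ->] [z' ->]; exists (z' - z); rewrite intrB.
Qed.

Lemma contracts_shift t w A : Tp t -> contracts tt d phi A (theta t w) ->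
  contracts tt d phi (phi t w @^-1` A) w.
Proof.
move=> Tt cA e e0; have [t0 h] := cA e e0; exists (Num.max 0 t0 + t) => s Ts s0 x y Ax Ay.
have ts : t <= s.
  by rewrite (le_trans _ s0)// lerDr le_max lexx.
have -> : s = t + (s - t) by rewrite addrC subrK.
have Tst := Tplus_sub Tt Ts ts.
rewrite !(phi_cocycle rds _ _ Tt Tst); apply: h => //.
by rewrite lerBrDr (le_trans _ s0)// lerD2r le_max lexx orbT.
Qed.

Lemma contracted_shift t w z : Tp t -> contracted (phi2 phi t w z) (theta t w) ->
  contracted z w.
Proof.
move=> Tt [V [oV V1 V2 cV]]; exists (phi t w @^-1` V); split=> //.
  exact: dcontinuous_preimage_open (phi_continuous rds w Tt) oV.
exact: contracts_shift.
Qed.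

(** A distance above [e] is an open condition: it survives a move to nearby dense points and then to
    a slightly later rational time. *)
Lemma contracts_dense V w : dopen d V ->
  (forall k : nat, exists n : nat, forall q, rtime q -> n%:R <= q ->
    forall a b, V (u a) -> V (u b) -> d (phi q w (u a)) (phi q w (u b)) <= k.+1%:R^-1) ->
  contracts tt d phi V w.
Proof.
have md := rds_metric rds; move=> oV h e e0.
have [k ke] := inv_succ_lt e0; have [n hn] := h k; exists n%:R => t Tt nt x y Vx Vy.
rewrite leNgt; apply/negP => lt_e.
have oW := @dist_gt_open2 _ _ _ md e.
have [r [r0 hr]] := oW _ _ lt_e.
have [r1 [r10 h1]] := phi_continuous rds w Tt x r0.
have [r2 [r20 h2]] := phi_continuous rds w Tt y r0.
have [a [Va ax]] := dense_open md hu oV Vx r10.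
have [b [Vb by_]] := dense_open md hu oV Vy r20.
have [|q [rq tq]] := open_hit_rtime (w := w) (z := (u a, u b)) rds Tt oW.
  by apply: hr; [apply: h1|apply: h2]; rewrite (is_metric_sym md).
apply/negP; rewrite -leNgt; apply: le_trans (ltW ke).
by apply: hn => //; exact: le_trans tq.
Qed.

(** Two balls, because the points of a pair may be far apart; any contracting open set around both
    contains such a union, which leaves countably many events. *)
Definition base_contraction (i : (nat * nat) * (nat * nat)) : set Omega :=
  [set w | contracts tt d phi (bb i.1 `|` bb i.2) w].
Local Notation CB := base_contraction.

Lemma base_pair_open (i : (nat * nat) * (nat * nat)) : dopen d (bb i.1 `|` bb i.2).
Proof. by apply: dopenU; apply: base_ball_open; exact: (rds_metric rds). Qed.

Lemma base_contraction_measurable i : @measurable _ Om0 (CB i).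
Proof.
have md := rds_metric rds; pose V := bb i.1 `|` bb i.2.
rewrite (_ : CB i = \bigcap_(k : nat) \bigcup_(n : nat)
    \bigcap_(q in [set q | rtime q /\ n%:R <= q])
      \bigcap_(c in [set c : nat * nat | V (u c.1) /\ V (u c.2)])
        [set w | d (phi q w (u c.1)) (phi q w (u c.2)) <= k.+1%:R^-1]).
  apply: bigcapT_measurable => k; apply: bigcupT_measurable => n.
  apply: countable_bigcap_measurable.
    by apply: sub_countable (rtime_countable tt); apply: subset_card_le => q [].
  move=> q [/rtimeP Tq _]; apply: countable_bigcap_measurable; first exact: countableP.
  move=> c _; apply: (F_future Tq).
  rewrite -(F_measurableE rds)//.
  have := phi2_measurable rds (u c.1, u c.2) Tq measurableT
    (@dist_le_measurable _ _ _ u md hu k.+1%:R^-1).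
  by rewrite setTI.
apply/seteqP; split=> w.
  move=> cw k _; have k0 : 0 < k.+1%:R^-1 :> R by rewrite invr_gt0.
  have [t0 h] := cw _ k0; exists (Num.bound `|t0|) => // q [rq nq] c [Va Vb] /=.
  apply: h => //; first exact: rtimeP.
  apply: le_trans nq; apply: le_trans (ler_norm t0) _.
  exact/ltW/archi_boundP.
move=> h; apply: contracts_dense; first exact: base_pair_open.
move=> k; have [n _ hn] := h k I; exists n => q rq nq a b Va Vb.
exact: (hn q (conj rq nq) (a, b) (conj Va Vb)).
Qed.

Lemma jointly_contractedP z w :
  contracted z w <-> exists i, [/\ bb i.1 z.1, bb i.2 z.2 & CB i w].
Proof.
have md := rds_metric rds; split=> [[V [oV V1 V2 cV]]|[i [i1 i2 cw]]].
  have [i [iz iV]] := base_ballP md hu oV V1.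
  have [j [jz jV]] := base_ballP md hu oV V2.
  exists (i, j); split=> //; apply: contractsS cV.
  by move=> x [/iV|/jV].
exists (bb i.1 `|` bb i.2); split=> //; [exact: base_pair_open|by left|by right].
Qed.

Definition contraction_event : set (XB d * XB d * Om0) :=
  [set zw | contracted zw.1 zw.2].

Lemma contraction_event_measurable : measurable contraction_event.
Proof.
rewrite (_ : contraction_event =
    \bigcup_(i in setT) ((bb i.1 `*` bb i.2) `*` CB i)).
  apply: countable_bigcup_measurable; first exact: countableP.
  move=> i _; apply: measurableX; last exact: base_contraction_measurable.
  by apply: measurableX; apply: base_ball_measurable; exact: (rds_metric rds).
apply/seteqP; split=> [[z w] /jointly_contractedP[i []]|[z w] [i _ [[/= i1 i2] cw]]].
  by exists i.
by apply/jointly_contractedP; exists i.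
Qed.

(** The set where [h] is positive, in the form of a union of open rectangles. *)
Definition contractible_pairs : set (X * X) :=
  [set z | exists i, [/\ bb i.1 z.1, bb i.2 z.2 & (0 < P (CB i))%E]].
Local Notation W := contractible_pairs.

Lemma contractible_pairs_open : dopen2 d W.
Proof.
have md := rds_metric rds; move=> a b [i [/= ia ib Pi]].
have [e [e0 he]] := base_ball_open md ia; have [r [r0 hr]] := base_ball_open md ib.
exists (Num.min e r); rewrite lt_min e0; split=> // a' b'.
by rewrite !lt_min => /andP[ae _] /andP[_ br]; exists i; split=> //; [exact: he|exact: hr].
Qed.

Lemma contractible_pairs_past q z : Tp q -> F 0 q [set w | W (phi2 phi q w z)].
Proof.
move=> Tq; rewrite -(F_measurableE rds)//.
have := phi2_measurable rds z Tq measurableT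
  (dopen2_measurable (rds_metric rds) hu contractible_pairs_open).
by rewrite setTI.
Qed.

(** Reaching a rectangle at time [q] and its contraction under the shifted noise are independent, so
    both occur together with positive probability. The preimage of the contracting set then
    contracts and contains both points of [z]. *)
Lemma reach_contractible_pairs q z : Tp q ->
  (0 < P [set w | W (phi2 phi q w z)])%E -> W z.
Proof.
move=> Tq h; have md := rds_metric rds.
have FD i : F 0 q [set w | bb i.1 (phi q w z.1) /\ bb i.2 (phi q w z.2)].
  rewrite -(F_measurableE rds)//.
  have mB : measurable (bb i.1 `*` bb i.2 : set (XB d * XB d)).
    by apply: measurableX; exact: base_ball_measurable.
  by have := phi2_measurable rds z Tq measurableT mB; rewrite setTI.
have [|||i Pi hi] := countable_bigcup_measure_gt0
    (A := fun i : (nat * nat) * (nat * nat) =>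
      [set w | bb i.1 (phi q w z.1) /\ bb i.2 (phi q w z.2)])
    (countableP [set i | (0 < P (CB i))%E]) _ _ _ h.
- by move=> i _; exact: (F_sub rds Tq (FD i)).
- exact: (F_sub rds Tq (contractible_pairs_past z Tq)).
- by move=> w [i [? ? ?]]; exists i.
have mC := base_contraction_measurable i.
have := shift_indep rds Tq (FD i) mC.
move=> e; have {e hi} : (0 < P ([set w | bb i.1 (phi q w z.1) /\ bb i.2 (phi q w z.2)]
    `&` theta q @^-1` CB i))%E by rewrite e; exact: mule_gt0.
move=> hi.
(* The preimage varies with the outcome; the pigeonhole finds base balls that work with positive
   probability. *)
have [|||j [j1 j2] hj] := countable_bigcup_measure_gt0 (A := CB)
    (countableP [set j | bb j.1 z.1 /\ bb j.2 z.2]) _ _ _ hi.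
- by move=> j _; apply: (future_measurable rds); exact: base_contraction_measurable.
- apply: measurableI; first exact: (F_sub rds Tq (FD i)).
  rewrite -[X in measurable X]setTI; apply: (theta_measurable rds Tq) => //.
  exact: (future_measurable rds).
- move=> w [[w1 w2] cw].
  have /jointly_contractedP[j [j1 j2 cj]] : contracted z w.
    apply: (contracted_shift Tq); apply/jointly_contractedP.
    by exists i.
  by exists j.
by exists j.
Qed.

End contraction.

Arguments jointly_contracted {R} tt {dO Omega X} d phi z w.
Arguments base_contraction {R} tt {dO Omega X} d phi u i _.
Arguments contraction_event {R} tt {dO Omega} F {X} d phi _.
Arguments contractible_pairs {R} tt {dO Omega} P {X} d phi u _.

(** * Contraction of almost every pair *)

Section synchronisation.
Context {R : realType} {tt : timeset} {dO : measure_display}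
  {Omega : measurableType dO} {F : R -> R -> set (set Omega)}
  {theta : R -> Omega -> Omega} {P : probability Omega R}
  {X : pointedType} {d : X -> X -> R} {phi : R -> Omega -> X -> X}
  {rho : probability (XB d) R}.
Hypothesis rds : RDS_memoryless tt F theta P d phi.
Hypothesis erg : ergodic tt P phi rho.
Variable (u : nat -> X).
Hypothesis hu : forall x e, 0 < e -> exists n, d (u n) x < e.
Local Notation Tp := (@Tplus R tt).
Local Notation rtime := (@rtime R tt).
Local Notation Om0 := (g_sigma_algebraType (@future R tt dO Omega F)).
Local Notation Omt t := (g_sigma_algebraType (F 0 t)).
Local Notation bb := (base_ball d u).
Local Notation CB := (base_contraction tt d phi u).
Local Notation W := (contractible_pairs tt P d phi u).
Local Notation EW := (contraction_event tt F d phi).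

Lemma stable_base_ball : stable_wrt tt P d phi rho ->
  exists i, (0 < rho (bb i))%E /\ (0 < P (CB (i, i)))%E.
Proof.
move=> [B [mB [BS PB]]].
have [||i ri Pi] := countable_bigcup_measure_gt0 (A := fun i => CB (i, i))
    (countableP [set i | (0 < rho (bb i))%E]) _ mB _ PB; last by exists i.
- move=> i _; apply: (future_measurable rds).
  exact: (base_contraction_measurable rds hu).
- move=> w /BS[U [oU [[p [Up sp]] cU]]].
  have [i [ip iU ri]] := supp_base_ball rds hu oU Up sp.
  by exists i => //; apply: contractsS cU; rewrite /= setUid.
Qed.

Lemma reach_of_Ppos_open (Q : set (X * X)) z : dopen2 d Q ->
  Ppos P [set w | exists t, Tplus tt t /\ Q (phi2 phi t w z)] ->
  exists2 q, rtime q & (0 < P [set w | Q (phi2 phi q w z)])%E.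
Proof.
move=> oQ [B [mB [BS PB]]].
apply: (countable_bigcup_measure_gt0 (rtime_countable tt) _ mB _ PB
  (A := fun q => [set w | Q (phi2 phi q w z)])) => [q rq|w /BS[t [Tt Qt]]].
  have Tq := rtimeP rq; apply: (F_sub rds Tq); rewrite -(F_measurableE rds)//.
  have := phi2_measurable rds z Tq measurableT
    (dopen2_measurable (rds_metric rds) hu oQ).
  by rewrite setTI.
by have [q [rq _ Qq]] := open_hit_rtime rds Tt oQ Qt; exists q.
Qed.

(** A transitive point may enter a charged ball that contracts with positive probability. Hence the
    open set [W] is a neighbourhood of the diagonal over the transitive points, and [CA] can be
    tested on it. *)
Lemma Arho_contractible x : stable_wrt tt P d phi rho ->
  Arho tt P d phi rho x -> W (x, x).
Proof.
have md := rds_metric rds; move=> /stable_base_ball[i [ri Pi]] [sx hx].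
have oB : dopen2 d (bb i `*` bb i).
  move=> a b [/= ia ib].
  have [e [e0 he]] := base_ball_open md ia; have [r [r0 hr]] := base_ball_open md ib.
  exists (Num.min e r); rewrite lt_min e0; split=> // a' b'.
  by rewrite !lt_min => /andP[ae _] /andP[_ br]; split; [exact: he|exact: hr].
have [B [mB [BS PB]]] := hx _ (base_ball_open md (u := u) (i := i)) ri.
have [|q rq hq] := reach_of_Ppos_open (z := (x, x)) oB.
  by exists B; split=> //; split=> // w /BS[t [Tt it]]; exists t.
apply: (reach_contractible_pairs rds hu (rtimeP rq)).
apply: lt_le_trans hq _; apply: le_measure; rewrite ?inE.
- have Tq := rtimeP rq; apply: (F_sub rds Tq); rewrite -(F_measurableE rds)//.
  have := phi2_measurable rds (x, x) Tq measurableT (dopen2_measurable md hu oB).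
  by rewrite setTI.
- have Tq := rtimeP rq; apply: (F_sub rds Tq).
  exact: (contractible_pairs_past rds hu).
- by move=> w [/= w1 w2]; exists (i, i).
Qed.

Lemma CA_contractible x y : stable_wrt tt P d phi rho ->
  CA tt P d phi (Arho tt P d phi rho) x y -> W (x, y).
Proof.
move=> st h; have oW := contractible_pairs_open rds (u := u).
have [|q rq hq] := reach_of_Ppos_open (z := (x, y)) oW.
  apply: h; exists W; split=> //; split=> // -[a b] [/= Aa ->].
  exact: Arho_contractible.
exact: (reach_contractible_pairs rds hu (rtimeP rq) hq).
Qed.

(** A pair in [B1] and [B2] has a positive chance of being in [A1] and [A2] at a common time, hence
    in [W], and [reach_contractible_pairs] carries this back to time zero. *)
Lemma contractible_full_rectangle : stable_wrt tt P d phi rho ->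
  has_full_rect d rho (CA tt P d phi (Arho tt P d phi rho)) ->
  exists B1 B2, [/\ dborel d B1, dborel d B2, rho B1 = 1%E, rho B2 = 1%E &
    forall x y, B1 x -> B2 y -> W (x, y)].
Proof.
move=> st [A1 [A2 [mA1 [mA2 [rA1 [rA2 hA]]]]]].
have AW x y : A1 x -> A2 y -> W (x, y) by move=> ? ?; exact/CA_contractible/hA.
have mC : dborel d (~` A2) by exact: (@measurableC _ (XB d)).
have C0 : rho (~` A2) = 0%E by rewrite probability_setC// rA2 subee.
(* Points almost surely in [A2] at every rational time; by stationarity the null complement of [A2]
   is reached only from a null set. *)
pose B2 := ~` reaching tt P phi (~` A2).
have mB2 : dborel d B2.
  by apply: (@measurableC _ (XB d)); exact: (reaching_measurable rds hu).
exists (reaching tt P phi A1), B2; split=> //.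
- exact: (reaching_measurable rds hu).
- exact: (reaching_full rds erg hu).
- rewrite probability_setC; last exact: (reaching_measurable rds hu).
  suff -> : rho (reaching tt P phi (~` A2)) = 0%E by rewrite sube0.
  apply/eqP; rewrite -measure_le0 leNgt; apply/negP => h.
  have [||q rq hq] := countable_bigcup_measure_gt0 (T := XB d) (rtime_countable tt)
    _ (reaching_measurable rds hu mC) _ h
    (A := fun q => [set x | (0 < P [set w | (~` A2) (phi q w x)])%E]).
  + by move=> q /rtimeP Tq; exact: (hit_positive_measurable rds hu Tq mC).
  + by move=> x [q rq ?]; exists q.
  have Tq := rtimeP rq; have mM := phi_preimage_measurable rds hu Tq mC.
  have := (product_null_aeP rho (P0 rds) mM).1.
  rewrite (stationary_product rds erg Tq mC) => /(_ C0) ae0.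
  have [x [/= h1 h2]] := ae_probability_exists (T := XB d)
    (hit_positive_measurable rds hu Tq mC) hq ae0.
  move: h1; rewrite ltNge => /negP; apply; rewrite -h2.
  by rewrite (xsection_set (fun x w => (~` A2) (phi q w x))).
move=> x y [q rq hq] /forall2NP ny; have Tq := rtimeP rq.
have mP z (S : set X) (mS : dborel d S) : measurable [set w | S (phi q w z)].
  exact: (F_sub rds Tq (phi_past rds z Tq mS)).
apply: (reach_contractible_pairs rds hu Tq).
have y0 : P [set w | (~` A2) (phi q w y)] = 0%E.
  have [//|/negP] := ny q; rewrite -leNgt measure_le0 => /eqP //.
have mW := F_sub rds Tq (contractible_pairs_past rds hu (x, y) Tq).
apply: lt_le_trans hq _.
apply: (@le_trans _ _ (P ([set w | W (phi2 phi q w (x, y))] `|`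
    [set w | (~` A2) (phi q w y)]))).
  apply: le_measure; rewrite ?inE; first exact: mP.
    by apply: measurableU => //; exact: mP.
  move=> w /= A1w; have [A2w|] := pselect (A2 (phi q w y)); last by right.
  by left; exact: AW.
apply: le_trans (measureU2 _ _ _) _ => //; first exact: mP.
by rewrite [X in (_ + X)%E](_ : _ = 0%E) ?adde0.
Qed.

(* The flow of two points has marginals [rho] at every time, so compact sets of
   almost full measure confine pairs with probability close to one; on them the
   probability of contraction is bounded below by compactness. *)
Lemma contraction_event_full : stable_wrt tt P d phi rho ->
  has_full_rect d rho (CA tt P d phi (Arho tt P d phi rho)) ->
  (((rho \x rho) \x P0 rds) (~` EW) = 0)%E.
Proof.
move=> st /(contractible_full_rectangle st)[B1 [B2 [mB1 mB2 rB1 rB2 hB]]].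
have md := rds_metric rds.
pose mu : probability (XB d * XB d)%type R := (rho \x rho)%E.
pose M : probability (XB d * XB d * Om0)%type R := (mu \x P0 rds)%E.
have mproj1 : measurable_fun setT
    ((fun z => (z.1.1, z.2)) : XB d * XB d * Om0 -> (XB d * Om0)%type).
  apply: measurable_fun_pair; last exact: measurable_snd.
  exact: measurableT_comp measurable_fst measurable_fst.
have mproj2 : measurable_fun setT
    ((fun z => (z.1.2, z.2)) : XB d * XB d * Om0 -> (XB d * Om0)%type).
  apply: measurable_fun_pair; last exact: measurable_snd.
  exact: measurableT_comp measurable_snd measurable_fst.
pose p1 : {mfun (XB d * XB d * Om0)%type >-> (XB d * Om0)%type} := mfun_Sub (mem_set mproj1).
pose p2 : {mfun (XB d * XB d * Om0)%type >-> (XB d * Om0)%type} := mfun_Sub (mem_set mproj2).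
(* Forgetting one starting point leaves the stationary one-point motion, started from [rho] with
   independent noise. *)
have marg1 S : measurable S -> M [set z | S (z.1.1, z.2)] = (rho \x P0 rds)%E S.
  move=> mS; rewrite (@product_measure_unique _ _ _ _ R rho (P0 rds) (distribution M p1))//.
  move=> A C mA mC.
  rewrite [LHS](_ : _ = M ((A `*` setT) `*` C)); last first.
    by congr (M _); apply/seteqP; split=> -[[a b] w] /=; tauto.
  rewrite -[LHS]/((mu \x P0 rds) _)%E product_measure1E//; last exact: measurableX.
  rewrite -[X in (X * _)%E]/((rho \x rho) _)%E product_measure1E//.
  by rewrite [X in (_ * X * _)%E](_ : _ = 1%E) ?mule1//; exact: probability_setT.
have marg2 S : measurable S -> M [set z | S (z.1.2, z.2)] = (rho \x P0 rds)%E S.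
  move=> mS; rewrite (@product_measure_unique _ _ _ _ R rho (P0 rds) (distribution M p2))//.
  move=> A C mA mC.
  rewrite [LHS](_ : _ = M ((setT `*` A) `*` C)); last first.
    by congr (M _); apply/seteqP; split=> -[[a b] w] /=; tauto.
  rewrite -[LHS]/((mu \x P0 rds) _)%E product_measure1E//; last exact: measurableX.
  rewrite -[X in (X * _)%E]/((rho \x rho) _)%E product_measure1E//.
  by rewrite [X in (X * _ * _)%E](_ : _ = 1%E) ?mul1e//; exact: probability_setT.
have mEW := contraction_event_measurable rds hu.
apply: (@recurrent_full _ _ _ _ _ _ _ _ _ _ rds _ (XB d * XB d)%type mu
  (fun n => phi2 phi n%:R)) => //.
- by move=> n; exact: (phi2_jointly_measurable rds hu (Tplus_nat tt n)).
- by move=> n z; exact: (phi2_measurable rds z (Tplus_nat tt n)).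
- by move=> n z w; exact: (contracted_shift rds (Tplus_nat tt n)).
move=> r r0; have r2 : 0 < r / 2 by rewrite divr_gt0.
have bd := rds_completion rds; have sd := rds_separable rds.
have [K1 [KB1 mK1 cK1 rK1]] := tightness rho md sd bd mB1 r2.
have [K2 [KB2 mK2 cK2 rK2]] := tightness rho md sd bd mB2 r2.
have rC B K : dborel d B -> dborel d K -> rho B = 1%E ->
    (rho (B `\` K) < (r / 2)%:E)%E -> (rho (~` K) <= (r / 2)%:E)%E.
  move=> mB mK rB h; apply: le_trans (ltW h).
  have mC S : dborel d S -> dborel d (~` S) by exact: (@measurableC _ (XB d)).
  apply: (@le_trans _ _ (rho ((~` B) `|` (B `\` K)))).
    apply: le_measure; rewrite ?inE; first exact: mC.
      by apply: measurableU; [exact: mC|exact: (@measurableD _ (XB d))].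
    by move=> x nK; have [?|?] := pselect (B x); [right|left].
  apply: le_trans (measureU2 _ _ _) _; [exact: mC|exact: (@measurableD _ (XB d))|].
  have B0 : rho (~` B) = 0%E by rewrite probability_setC// rB subee.
  by rewrite [X in (X + _)%E](_ : _ = 0%E) ?add0e.
(* Rectangles are enumerated by codes; a number coding nothing, or an index whose contraction event
   is null, gives the empty set and covers no pair. *)
pose G k := if unpickle k is Some i then
  [set x | (0 < P (CB i))%E /\ bb i.1 x] else set0 : set X.
pose H k := if unpickle k is Some i then
  [set x | (0 < P (CB i))%E /\ bb i.2 x] else set0 : set X.
have oS (Q : Prop) (B : set X) : dopen d B -> dopen d [set x | Q /\ B x].
  by move=> oB x [q /oB[e [e0 he]]]; exists e; split=> // y /he.
have [|||N hN] := seq_compact_tube md cK1 cK2 (G := G) (H := H).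
- by move=> k; rewrite /G; case: (unpickle k) => [i|//]; exact/oS/base_ball_open.
- by move=> k; rewrite /H; case: (unpickle k) => [i|//]; exact/oS/base_ball_open.
- move=> x y /KB1 Bx /KB2 By; have [i [i1 i2 Pi]] := hB x y Bx By.
  by exists (pickle i); rewrite /G /H pickleK.
(* The least of the positive contraction probabilities among the codes below [N]. *)
have [e [e0 he]] : exists e : R, 0 < e /\ forall k, (k < N)%N ->
    forall i : (nat * nat) * (nat * nat), unpickle k = Some i ->
    (0 < P (CB i))%E -> (e%:E <= P (CB i))%E.
  elim: N {hN} => [|N [e [e0 he]]]; first by exists 1.
  case uN : (unpickle N : option ((nat * nat) * (nat * nat))) => [i|]; last first.
    exists e; split=> // k; rewrite ltnS leq_eqVlt => /orP[/eqP->|/he//].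
    by move=> i; rewrite uN.
  have [Pi|nPi] := pselect (0 < P (CB i))%E; last first.
    exists e; split=> // k; rewrite ltnS leq_eqVlt => /orP[/eqP->|/he//].
    by move=> j; rewrite uN => -[<-].
  have mi : measurable (CB i).
    by apply: (future_measurable rds); exact: (base_contraction_measurable rds hu).
  have fi : P (CB i) \is a fin_num by exact: fin_num_measure.
  exists (Num.min e (fine (P (CB i)))); split.
    by rewrite lt_min e0/= -lte_fin fineK.
  move=> k; rewrite ltnS leq_eqVlt => /orP[/eqP->|kN].
    by move=> j; rewrite uN => -[<-] _; rewrite -[leRHS]fineK// lee_fin ge_min lexx orbT.
  move=> j uj Pj; apply: le_trans (he k kN j uj Pj).
  by rewrite lee_fin ge_min lexx.
exists e, (K1 `*` K2); split=> //; first exact: measurableX.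
- move=> [x y] [/= Kx Ky]; have [k kN] := hN x y Kx Ky.
  rewrite /G /H; case uk : (unpickle k) => [i|]; last by case.
  move=> [[Pi i1] [_ i2]].
  apply: le_trans (he k kN i uk Pi) _; apply: le_measure; rewrite ?inE.
  + by apply: (future_measurable rds); exact: (base_contraction_measurable rds hu).
  + by apply: (future_measurable rds); exact: measurable_xsection.
  + move=> w cw; rewrite /xsection /= inE.
    by apply/(jointly_contractedP rds hu); exists i.
- move=> n; have Tn := @Tplus_nat R tt n.
  have mK12 : measurable (K1 `*` K2 : set (XB d * XB d)) by exact: measurableX.
  have mC1 := phi_preimage_measurable rds hu Tn (@measurableC _ (XB d) _ mK1).
  have mC2 := phi_preimage_measurable rds hu Tn (@measurableC _ (XB d) _ mK2).
  pose S1 := [set z : XB d * Om0 | (~` K1) (phi n%:R z.2 z.1)].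
  pose S2 := [set z : XB d * Om0 | (~` K2) (phi n%:R z.2 z.1)].
  have m1 : measurable [set z : XB d * XB d * Om0 | S1 (z.1.1, z.2)].
    by rewrite -[X in measurable X]setTI; exact: (mproj1 measurableT _ mC1).
  have m2 : measurable [set z : XB d * XB d * Om0 | S2 (z.1.2, z.2)].
    by rewrite -[X in measurable X]setTI; exact: (mproj2 measurableT _ mC2).
  have h1 : (M [set z | S1 (z.1.1, z.2)] <= (r / 2)%:E)%E.
    rewrite marg1// (stationary_product rds erg (A := ~` K1))//.
      exact: rC rK1.
    exact: (@measurableC _ (XB d) _ mK1).
  have h2 : (M [set z | S2 (z.1.2, z.2)] <= (r / 2)%:E)%E.
    rewrite marg2// (stationary_product rds erg (A := ~` K2))//.
      exact: rC rK2.
    exact: (@measurableC _ (XB d) _ mK2).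
  (* Leaving the product of compact sets means that one coordinate leaves its own, so the marginals
     suffice. *)
  apply: (@le_trans _ _ (M ([set z | S1 (z.1.1, z.2)] `|` [set z | S2 (z.1.2, z.2)]))).
    apply: le_measure; rewrite ?inE; [|exact: measurableU|].
      rewrite -[X in measurable X]setTI.
      have := phi2_jointly_measurable rds hu Tn measurableT
        (measurableC mK12).
      exact.
    move=> z /not_andP[]; [by left|by right].
  apply: le_trans (measureU2 _ _ _) _ => //.
  by rewrite (splitr r) EFinD; exact: leeD.
Qed.

End synchronisation.

(** * Equivalence of the four conditions *)

Lemma ae_Ppos {R : realType} {dO} {Omega : measurableType dO}
    (P : probability Omega R) (Q : Omega -> Prop) :
  {ae P, forall w, Q w} -> Ppos P Q.
Proof.
move=> [N [mN N0 hN]]; exists (~` N); split; first exact: measurableC.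
split; last by rewrite probability_setC// N0 sube0 lte01.
by move=> w Nw; apply: contrapT => /hN.
Qed.

Section equivalence.
Context {R : realType} {tt : timeset} {dO : measure_display}
  {Omega : measurableType dO} {F : R -> R -> set (set Omega)}
  {theta : R -> Omega -> Omega} {P : probability Omega R}
  {X : pointedType} {d : X -> X -> R} {phi : R -> Omega -> X -> X}
  {rho : probability (XB d) R}.
Hypothesis rds : RDS_memoryless tt F theta P d phi.
Hypothesis erg : ergodic tt P phi rho.
Variable (u : nat -> X).
Hypothesis hu : forall x e, 0 < e -> exists n, d (u n) x < e.
Local Notation Tp := (@Tplus R tt).
Local Notation rtime := (@rtime R tt).
Local Notation Om0 := (g_sigma_algebraType (@future R tt dO Omega F)).
Local Notation Omt t := (g_sigma_algebraType (F 0 t)).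
Local Notation bb := (base_ball d u).
Local Notation EW := (contraction_event tt F d phi).

Lemma ae_future (Q : Omega -> Prop) :
  {ae P0 rds, forall w : Om0, Q w} -> {ae P, forall w, Q w}.
Proof.
by move=> [N [mN N0 hN]]; exists N; split=> //; exact: (future_measurable rds).
Qed.

Lemma ae_to_future (Q : set Omega) : @measurable _ Om0 Q ->
  {ae P, forall w, Q w} -> {ae P0 rds, forall w : Om0, Q w}.
Proof.
move=> mQ hQ; have mC := @measurableC _ Om0 _ mQ.
exists (~` Q); split=> //; rewrite -[LHS]/(P (~` Q)).
by apply/negligibleP => //; exact: (future_measurable rds).
Qed.

(** The pairs for which the exceptional event [N] is not negligible: a measurable set, so Fubini can
    fix one of the two points. *)
Definition charged_pairs (N : set (XB d * XB d * Om0)) : set (XB d * XB d) :=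
  [set z | (P0 rds \o xsection N) z != 0%E].

Lemma charged_pairs_measurable N : measurable N -> measurable (charged_pairs N).
Proof.
move=> mN; rewrite -[X in measurable X]setTI.
by apply: emeasurable_neq => //; exact: measurable_fun_xsection.
Qed.

Lemma charged_pairs_null N : measurable N ->
  (((rho \x rho) \x P0 rds) N = 0)%E ->
  {ae rho, forall x : XB d, rho (xsection (charged_pairs N) x) = 0%E}.
Proof.
move=> mN N0; apply/product_null_aeP; first exact: charged_pairs_measurable.
have h := (product_null_aeP (rho \x rho)%E (P0 rds) mN).1 N0.
apply/(negligibleP _ (charged_pairs_measurable mN)).
by apply: negligibleS h => z /= /eqP.
Qed.

Lemma contraction_class_open x w :
  dopen d [set y | jointly_contracted tt d phi (x, y) w].
Proof.
move=> y [V [oV Vx Vy cV]]; have [e [e0 he]] := oV y Vy.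
by exists e; split=> // y' /he Vy'; exists V.
Qed.

(** Stage [n] unites the finitely many contracting base pairs of code at most [n] whose first ball
    contains [x]. Each collapses onto the trajectory of [x], so the triangle inequality through it
    makes the union contract. *)
Lemma sigma_contracting_class x w :
  sigma_contracting tt d phi [set y | jointly_contracted tt d phi (x, y) w] w.
Proof.
have md := rds_metric rds.
split; first exact: contraction_class_open.
pose good (i : (nat * nat) * (nat * nat)) := bb i.1 x /\ base_contraction tt d phi u i w.
exists (fun n => [set y | exists i, [/\ (pickle i <= n)%N, good i & (bb i.1 `|` bb i.2) y]]).
have V0 n e : 0 < e -> exists t0, forall t, Tp t -> t0 <= t -> forall i y,
    (pickle i < n)%N -> good i -> (bb i.1 `|` bb i.2) y ->
    d (phi t w x) (phi t w y) <= e.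
  move=> e0; elim: n => [|n [t0 IH]]; first by exists 0.
  have [[i [/eqP ni gi]]|nex] := pselect (exists i, pickle i == n /\ good i).
    have [t1 h1] := gi.2 e e0; exists (Num.max t0 t1) => t Tt.
    rewrite ge_max => /andP[t0t t1t] j y.
    rewrite ltnS leq_eqVlt => /orP[/eqP jn|jn] gj jy; last exact: (IH t Tt t0t j).
    have ij : i = j by apply: (pcan_inj pickleK); rewrite ni jn.
    by apply: h1 => //; [left; case: gi|rewrite ij].
  exists t0 => t Tt t0t j y; rewrite ltnS leq_eqVlt => /orP[/eqP jn|jn] gj jy.
    by exfalso; apply: nex; exists j; rewrite jn.
  exact: (IH t Tt t0t j).
split; [|split; [|split]].
- move=> n y [i [il gi iy]]; have [e [e0 he]] := base_pair_open rds iy.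
  by exists e; split=> // y' /he; exists i.
- by move=> n y [i [il gi iy]]; exists i; split=> //; exact: leqW.
- move=> n e e0; have e2 : 0 < e / 2 by rewrite divr_gt0.
  have [t0 h0] := V0 n.+1 _ e2; exists t0 => t Tt t0t y y' [i [il gi iy]] [j [jl gj jy]].
  have := h0 t Tt t0t i y il gi iy; have := h0 t Tt t0t j y' jl gj jy.
  have := is_metric_triangle md (phi t w x) (phi t w y) (phi t w y').
  by rewrite (is_metric_sym md (phi t w y) (phi t w x)); lra.
- apply/seteqP; split=> y.
    move=> /(jointly_contractedP rds hu)[i [i1 i2 ci]].
    by exists (pickle i) => //; exists i; split=> //; right.
  move=> [n _ [i [_ [i1 ci] iy]]]; exists (bb i.1 `|` bb i.2); split=> //.
    exact: (base_pair_open rds).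
  by left.
Qed.

(** One typical [x] serves almost every outcome: Fubini in the remaining variables, sliced by [w]
    instead of [y], gives its contraction class full measure. *)
Lemma stably_sync_of_rectangle : stable_wrt tt P d phi rho ->
  has_full_rect d rho (CA tt P d phi (Arho tt P d phi rho)) ->
  ae_stably_sync tt P d phi rho.
Proof.
move=> st hr; have E0 := contraction_event_full rds erg hu st hr.
have mE : measurable EW := contraction_event_measurable rds hu.
have mC := measurableC mE.
have [x [_ hx]] := ae_probability_exists (T := XB d) measurableT
  ltac:(by rewrite probability_setT) (charged_pairs_null mC E0).
have mj : measurable_fun setT
    ((fun z => ((x, z.1), z.2)) : XB d * Om0 -> (XB d * XB d * Om0)%type).
  apply: measurable_fun_pair; last exact: measurable_snd.
  by apply: measurable_fun_pair; [exact: measurable_cst|exact: measurable_fst].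
pose Ex : set (XB d * Om0) := (fun z => ((x, z.1), z.2)) @^-1` (~` EW).
have mEx : measurable Ex by rewrite -[X in measurable X]setTI; exact: mj.
have Ex0 : ((rho \x P0 rds) Ex = 0)%E.
  apply/product_null_aeP => //.
  exists (xsection (charged_pairs (~` EW)) x); split=> //.
    by apply: measurable_xsection; exact: charged_pairs_measurable.
  move=> y /= ny; rewrite /xsection /= inE /charged_pairs /=; apply/eqP => h.
  apply: ny; apply: etrans h; rewrite -[RHS]/(P0 rds (xsection (~` EW) (x, y))).
  congr (P0 rds _).
have := (product_null_ysectionP rho (P0 rds) mEx).1 Ex0.
move=> h; apply: ae_future; apply: ae_imply h => w hw.
exists [set y | jointly_contracted tt d phi (x, y) w].
split; first exact: contraction_class_open.
split; last exact: sigma_contracting_class.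
have mU : @measurable _ (XB d) [set y | jointly_contracted tt d phi (x, y) w].
  by apply: dborel_open; exact: contraction_class_open.
rewrite -[X in rho X]setCK probability_setC; last exact: (@measurableC _ (XB d)).
rewrite (_ : rho (~` _) = 0%E) ?sube0// -hw; congr (rho _).
by apply/seteqP; split=> y; rewrite /ysection /= inE.
Qed.

Definition synchronised : set (XB d * XB d * Om0) :=
  \bigcap_(k : nat) \bigcup_(n : nat) \bigcap_(q in [set q | rtime q /\ n%:R <= q])
    [set zw | d (phi q zw.2 zw.1.1) (phi q zw.2 zw.1.2) <= k.+1%:R^-1].

Lemma synchronised_measurable : measurable synchronised.
Proof.
apply: bigcapT_measurable => k; apply: bigcupT_measurable => n.
apply: countable_bigcap_measurable.
  by apply: sub_countable (rtime_countable tt); apply: subset_card_le => q [].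
move=> q [/rtimeP Tq _].
have := phi2_jointly_measurable rds hu Tq measurableT
  (@dist_le_measurable _ _ _ u (rds_metric rds) hu k.+1%:R^-1).
by rewrite setTI.
Qed.

(** For a fixed outcome, any two points of [U] lie in a common contracting [Us n], and [U] times [U]
    is full. *)
Lemma ae_synchronised : ae_stably_sync tt P d phi rho ->
  (((rho \x rho) \x P0 rds) (~` synchronised) = 0)%E.
Proof.
move=> sy; have mS := measurableC synchronised_measurable.
pose mu : probability (XB d * XB d)%type R := (rho \x rho)%E.
apply/(product_null_ysectionP mu (P0 rds) mS).
apply: ae_to_future.
  rewrite -[X in measurable X]setTI.
  have := measurable_fun_ysection mu mS measurableT (emeasurable_set1 0%E).
  exact.
apply: ae_imply sy => w [U [oU [rU [_ [Us [_ [Us_mono [Us_c UE]]]]]]]].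
have mU : @measurable _ (XB d) U by exact: dborel_open.
have mUU : measurable (U `*` U : set (XB d * XB d)) by exact: measurableX.
have UU1 : mu (U `*` U) = 1%E.
  by rewrite -[LHS]/((rho \x rho) _)%E product_measure1E//
    [X in (X * _)%E](_ : _ = 1%E) ?mul1e.
have UU0 : mu (~` (U `*` U)) = 0%E by rewrite probability_setC// UU1 subee.
apply/eqP; rewrite -measure_le0 -UU0; apply: le_measure; rewrite ?inE.
- exact: measurable_ysection.
- exact: measurableC.
- move=> [x y]; rewrite /ysection /= inE /=; apply: contra_not => -[/= Ux Uy] k _.
  have mono m n : (m <= n)%N -> Us m `<=` Us n.
    elim: n => [|n IH]; first by rewrite leqn0 => /eqP ->.
    rewrite leq_eqVlt => /orP[/eqP->//|]; rewrite ltnS => /IH h.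
    exact: subset_trans h (Us_mono n).
  move: Ux Uy; rewrite UE => -[m _ mx] [n _ ny].
  have k0 : 0 < k.+1%:R^-1 :> R by rewrite invr_gt0.
  have [t0 h] := Us_c (maxn m n) _ k0; exists (Num.bound `|t0|) => // q [rq nq] /=.
  apply: h => //; first exact: rtimeP.
  + apply: le_trans nq; apply: le_trans (ler_norm t0) _.
    exact/ltW/archi_boundP.
  + exact: mono (leq_maxl _ _) _ mx.
  + exact: mono (leq_maxr _ _) _ ny.
Qed.

(** Joint visits of [x] and [y] come from one reference point [x0]: both approach its trajectory,
    and only this trajectory has to return. *)
Lemma simultaneous_visits : ae_stably_sync tt P d phi rho ->
  exists A : set X, dborel d A /\ rho A = 1%E /\ A `<=` supp d rho /\
    forall x y, A x -> A y ->
      {ae P, forall w, forall U, dopen d U -> (0 < rho U)%E ->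
         exists t, Tplus tt t /\ U (phi t w x) /\ U (phi t w y)}.
Proof.
move=> sy; have md := rds_metric rds; have S0 := ae_synchronised sy.
have mS := measurableC synchronised_measurable.
have hret : {ae rho, forall x : XB d, forall i, (0 < rho (bb i))%E -> forall n : nat,
    {ae P, forall w, exists q, [/\ rtime q, n%:R <= q & bb i (phi q w x)]}}.
  apply: ae_forall_countable => i.
  have [ri|nri] := pselect (0 < rho (bb i))%E; last exact: aeW.
  have := return_ae rds erg hu (base_ball_measurable u md i) ri.
  by apply: ae_imply => x.
have [x0 [_ [hx0 hr]]] := ae_probability_exists (T := XB d) measurableT
  ltac:(by rewrite probability_setT)
  (ae_imply2 (fun x a b => conj a b) (charged_pairs_null mS S0) hret).
pose C := xsection (charged_pairs (~` synchronised)) x0.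
have mC : measurable C by apply: measurable_xsection; exact: charged_pairs_measurable.
have mD : @measurable _ (XB d) (~` C) by exact: measurableC.
have msupp : @measurable _ (XB d) (supp d rho) := supp_measurable rds hu.
have s0 : rho (~` supp d rho) = 0%E.
  by rewrite probability_setC// (supp_full rds hu) subee.
exists (~` C `&` supp d rho); split; first exact: (@measurableI _ (XB d)).
split.
  rewrite -[X in rho X]setCK probability_setC; last first.
    by apply: (@measurableC _ (XB d)); exact: (@measurableI _ (XB d)).
  suff -> : rho (~` (~` C `&` supp d rho)) = 0%E by rewrite sube0.
  rewrite setCI setCK; apply/negligibleP.
    by apply: (@measurableU _ (XB d)) => //; exact: (@measurableC _ (XB d)).
  apply: negligibleU; first exact/negligibleP.
  by apply/negligibleP; [exact: (@measurableC _ (XB d))|exact: s0].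
split; first by move=> x [].
have hs x : ~ C x -> {ae P, forall w, synchronised ((x0, x), w)}.
  move=> nC; apply: ae_future.
  exists (xsection (~` synchronised) (x0, x)); split.
  - exact: measurable_xsection.
  - apply: contrapT => h; apply: nC; rewrite /C /xsection /= inE.
    exact/eqP.
  - by move=> w; rewrite /xsection /= inE.
have hv : {ae P, forall w, forall (i : nat * nat) (n : nat), (0 < rho (bb i))%E ->
    exists q, [/\ rtime q, n%:R <= q & bb i (phi q w x0)]}.
  apply: ae_forall_countable => i; apply: ae_forall_countable => n.
  have [ri|nri] := pselect (0 < rho (bb i))%E; last exact: aeW.
  by apply: ae_imply (hr i ri n).
move=> x y [/hs sx _] [/hs sy' _].
have sxy := ae_imply2 (fun w a b => conj a b) sx sy'.
apply: ae_imply2 sxy hv => w [wx wy] wv U oU rU.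
have [p [Up sp]] := ae_probability_exists (T := XB d) (dborel_open oU) rU
  (ae_full (T := XB d) msupp (supp_full rds hu)).
(* Half of the radius is for the visit of [x0], half for the distance from [x] or [y] to it. *)
have [e [e0 pU]] := oU p Up; have e2 : 0 < e / 2 by rewrite divr_gt0.
have [i [ip iU ri]] := supp_base_ball rds hu
  (@dball_open _ _ _ md p (e / 2)) (dball_center md p e2) sp.
have [k ke] := inv_succ_lt e2.
have [n _ hn] := wx k I; have [m _ hm] := wy k I.
(* The visit must come after both distances have become small; this is where late returns are
   used. *)
have [q [rq nq iq]] := wv i (maxn n m) ri.
have := iU _ iq; rewrite /dball /= => pq.
have qx := hn q (conj rq (le_trans _ nq)).
have qy := hm q (conj rq (le_trans _ nq)).
exists q; split; first exact: rtimeP.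
split; apply: pU; rewrite /dball /=.
  have := is_metric_triangle md (phi q w x0) p (phi q w x).
  have := qx ltac:(by rewrite ler_nat leq_maxl); rewrite /=.
  by move: (k.+1%:R^-1) ke => s; lra.
have := is_metric_triangle md (phi q w x0) p (phi q w y).
have := qy ltac:(by rewrite ler_nat leq_maxr); rewrite /=.
by move: (k.+1%:R^-1) ke => s; lra.
Qed.

End equivalence.

Theorem theorem2p11 (R : realType) (tt : timeset)
  (dO : measure_display) (Omega : measurableType dO)
  (F : R -> R -> set (set Omega)) (theta : R -> Omega -> Omega)
  (P : probability Omega R)
  (X : pointedType) (d : X -> X -> R) (phi : R -> Omega -> X -> X)
  (rho : probability (XB d) R) :
  RDS_memoryless tt F theta P d phi ->
  ergodic tt P phi rho ->
  stable_wrt tt P d phi rho ->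
  [<-> (* (i) *)
       (exists Rs : set X, dborel d Rs /\ (0 < rho Rs)%E /\
          forall p, Rs p -> has_full_rect d rho (Cp tt P d phi p));
       (* (ii) *)
       has_full_rect d rho (CA tt P d phi (Arho tt P d phi rho));
       (* (iii) *)
       ae_stably_sync tt P d phi rho;
       (* (iv) *)
       (exists A : set X, dborel d A /\ rho A = 1%E /\ A `<=` supp d rho /\
          forall x y, A x -> A y ->
            {ae P, forall w, forall U, dopen d U -> (0 < rho U)%E ->
               exists t, Tplus tt t /\ U (phi t w x) /\ U (phi t w y)})].
Proof.
move=> rds erg st; have md := rds_metric rds.
have [u hu] := separable_seq md (rds_separable rds).
split; [|split; [|split]].
(* Almost every point is transitive, so some target [p] is; a neighbourhood of the diagonal then
   contains a product of balls around [p]. *)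
- move=> [Rs [mRs [rRs hRs]]].
  have [p [Rp Ap]] := ae_probability_exists (T := XB d) mRs rRs (Arho_ae rds erg hu).
  have [A1 [A2 [mA1 [mA2 [r1 [r2 h]]]]]] := hRs p Rp.
  exists A1, A2; do 4 split=> //; move=> x y A1x A2y V [Q [oQ [AQ QV]]].
  have [e [e0 he]] := oQ p p (AQ (p, p) (conj Ap erefl)).
  have [B [mB [BS PB]]] := h x y A1x A2y e e0.
  exists B; split=> //; split=> // w /BS[t [Tt [tx ty]]].
  exists t; split=> //; apply: QV; apply: he; rewrite (is_metric_sym md)//.
- exact: (stably_sync_of_rectangle rds erg hu st).
- exact: (simultaneous_visits rds erg hu).
(* [A] is the set of targets and both sides of the rectangle; its points lie in the support, so the
   balls around them are charged and visited. *)
- move=> [A [mA [rA [As hA]]]]; exists A; split=> //.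
  split; first by rewrite rA lte01.
  move=> p Ap; exists A, A; split=> //; split=> //; split; first by rewrite rA lte01.
  split=> // x y Ax Ay e e0; apply: ae_Ppos.
  apply: ae_imply (hA x y Ax Ay) => w /(_ _ (@dball_open _ _ _ md p e) (As p Ap e e0)).
  move=> [t [Tt [tx ty]]]; exists t; split=> //.
  by split; rewrite (is_metric_sym md).
Qed.
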